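(* Let $d$ and $k$ be integers with $1\le k\le d-1$. There is a constant $C=C(d,k)$ such that the following holds. Let $\Lambda\subseteq\mathbb{R}^d$ be a $d$-dimensional lattice, write $\lambda_i=\lambda_i(\Lambda,B^d)$ for $i=1,\dots,d$, and assume $\lambda_d\le 1$. Then $\Lambda\cap B^d$ can be covered by at most $C\,\alpha^{d-k}$ $k$-dimensional linear subspaces of $\mathbb{R}^d$, where \[\alpha=\min_{d-k+1\le i\le d}(\lambda_{d-i+1}\cdots\lambda_d)^{-1/(i-1)}.\]
   Context: $B^d$ is the closed unit Euclidean ball in $\mathbb{R}^d$ centered at the origin. A $d$-dimensional lattice is the set of all integer linear combinations of $d$ linearly independent vectors of $\mathbb{R}^d$. For a lattice $\Lambda$ and a compact convex body $K$ symmetric about the origin, the $i$th successive minimum is $\lambda_i(\Lambda,K)=\inf\{\lambda\in\mathbb{R}:\dim(\Lambda\cap(\lambda K))\ge i\}$, where $\dim$ denotes the dimension of the affine hull. *)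

(* Defs.v *)
From HB Require Import structures.
From mathcomp Require Import all_boot all_order all_algebra.
From mathcomp Require Import all_classical all_reals.
From mathcomp Require Import exp.
Set Implicit Arguments. Unset Strict Implicit. Unset Printing Implicit Defensive.
Import Order.TTheory GRing.Theory Num.Theory.
Local Open Scope classical_set_scope.
Local Open Scope ring_scope.

Section Defs.
Variable R : realType.

Definition enorm (d : nat) (v : 'rV[R]_d) : R := Num.sqrt (\sum_(i < d) (v 0 i) ^+ 2).

Definition unit_ball {d : nat} : set 'rV[R]_d := [set x | enorm x <= 1].

Definition dilate (d : nat) (l : R) (K : set 'rV[R]_d) : set 'rV[R]_d :=
  [set l *: x | x in K].

Definition is_lattice (d : nat) (L : set 'rV[R]_d) : Prop :=
  exists B : 'M[R]_d, B \in unitmx /\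
    L = [set (map_mx (fun n : int => n%:~R) z) *m B | z in [set: 'rV[int]_d]].

Definition affdim_ge (d : nat) (S : set 'rV[R]_d) (i : nat) : Prop :=
  exists x : 'I_i.+1 -> 'rV[R]_d, (forall j, S (x j)) /\
    \rank (\matrix_(j < i) (x (lift ord0 j) - x ord0)) = i.

Definition succ_min (d : nat) (L K : set 'rV[R]_d) (i : nat) : R :=
  inf [set l : R | 0 < l /\ affdim_ge (L `&` dilate l K) i].

Definition alpha_term (d : nat) (L : set 'rV[R]_d) (i : nat) : R :=
  powR (\prod_(d - i + 1 <= j < d.+1) succ_min L (@unit_ball d) j)
       (- ((i - 1)%:R)^-1).

Definition alpha (d k : nat) (L : set 'rV[R]_d) : R :=
  \big[Num.min/alpha_term L d]_(d - k + 1 <= i < d.+1) alpha_term L i.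

End Defs.

(* Main.v *)
(** Write the lattice in a reduced basis b_1, ..., b_d with increasing lengths:
    its points in the ball have integer coordinates bounded by N_j = O(1 / |b_j|),
    and lambda_j <= |b_j|.  Forgetting the first d - i coordinates and pulling
    subspaces back, it suffices to cover the integer points of a box in Z^n
    (n = i) by O(T^c) subspaces of codimension c, where T^(n-1) = prod N_j and
    c = d - k < n.  This goes by induction on n.  For c = 0 or c = n - 1 it is
    trivial.  If some N_j exceeds T, drop the coordinate j: T does not increase.
    Otherwise the pigeonhole principle gives each point z of the box an integral
    normal w with ||w|| := max |w_j| N_j = O(T); take w shortest.  The points of
    the box orthogonal to w are contained, in a suitable basis of a rank n - 1
    sublattice, in a box of volume O(prod N_j / ||w||), which is covered by
    induction with codimension c - 1, and the resulting bounds sum over w to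
    O(T^c). *)
Require Import Defs.
From HB Require Import structures.
From mathcomp Require Import all_boot all_order all_algebra.
From mathcomp Require Import all_classical all_reals.
From mathcomp Require Import exp.
From mathcomp Require Import perm ring lra zify.
Import Order.TTheory GRing.Theory Num.Theory.
Local Open Scope classical_set_scope.
Local Open Scope ring_scope.

Set Implicit Arguments. Unset Strict Implicit. Unset Printing Implicit Defensive.

(** By the Leibniz formula: each of the [n!] products takes exactly one entry from every column. *)
Lemma det_le (R : realDomainType) n (A : 'M[R]_n) (N : 'I_n -> R) :
  (forall i j, `|A i j| <= N j) -> `|\det A| <= n`!%:R * \prod_j N j.
Proof.
move=> hA; rewrite /determinant.
apply: le_trans (ler_norm_sum _ _ _) _.
apply: (@le_trans _ _ (\sum_(s : 'S_n) \prod_j N j)); last first.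
  by rewrite sumr_const card_Sn mulr_natl.
apply: ler_sum => s _; rewrite normrM normrX normrN1 expr1n mul1r normr_prod.
rewrite (reindex_inj (@perm_inj _ s) (F := N)) /=.
by apply: ler_prod => i _; rewrite normr_ge0 hA.
Qed.

Section Covering.
Variable R : realType.
Local Notation "A ^r" := (map_mx (intmul (1 : R)) A) (at level 2, format "A ^r").

(** * Euclidean inner product, squared norm and projection *)

Definition dotr n (u v : 'rV[R]_n) : R := (u *m v^T) 0 0.
Definition sqn n (u : 'rV[R]_n) : R := \sum_i u 0 i ^+ 2.

Lemma sqnE n (u : 'rV[R]_n) : sqn u = dotr u u.
Proof. by rewrite /sqn /dotr mxE; apply: eq_bigr => i _; rewrite mxE expr2. Qed.

Lemma sqn_ge0 n (u : 'rV[R]_n) : 0 <= sqn u.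
Proof. by apply: sumr_ge0 => i _; rewrite sqr_ge0. Qed.

Lemma sqn_eq0 n (u : 'rV[R]_n) : sqn u = 0 -> u = 0.
Proof.
move=> /eqP; rewrite psumr_eq0; last by move=> i _; rewrite sqr_ge0.
move=> /allP h; apply/rowP => i; rewrite mxE; apply/eqP.
by rewrite -sqrf_eq0; apply: (h i); rewrite mem_index_enum.
Qed.

Lemma sqnZ n a (u : 'rV[R]_n) : sqn (a *: u) = a ^+ 2 * sqn u.
Proof. by rewrite /sqn mulr_sumr; apply: eq_bigr => i _; rewrite mxE exprMn. Qed.

Lemma le_sqn n (u : 'rV[R]_n) i : u 0 i ^+ 2 <= sqn u.
Proof.
rewrite /sqn (bigD1 i) //= lerDl; apply: sumr_ge0 => j _; exact: sqr_ge0.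
Qed.

Lemma dotrDl n (u v w : 'rV[R]_n) : dotr (u + v) w = dotr u w + dotr v w.
Proof. by rewrite /dotr mulmxDl mxE. Qed.
Lemma dotrDr n (u v w : 'rV[R]_n) : dotr w (u + v) = dotr w u + dotr w v.
Proof. by rewrite /dotr linearD /= mulmxDr mxE. Qed.
Lemma dotrZl n a (u w : 'rV[R]_n) : dotr (a *: u) w = a * dotr u w.
Proof. by rewrite /dotr -scalemxAl mxE. Qed.
Lemma dotrZr n a (u w : 'rV[R]_n) : dotr w (a *: u) = a * dotr w u.
Proof. by rewrite /dotr linearZ /= -scalemxAr mxE. Qed.
Lemma dotrC n (u v : 'rV[R]_n) : dotr u v = dotr v u.
Proof. by rewrite /dotr !mxE; apply: eq_bigr => i _; rewrite !mxE mulrC. Qed.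

(** For nonzero [b], the orthogonal projection along [b], acting on row vectors from the right. *)
Definition prjmx n (b : 'rV[R]_n) : 'M[R]_n := 1%:M - (sqn b)^-1 *: (b^T *m b).

Lemma mul_prjmx n (b v : 'rV[R]_n) : v *m prjmx b = v - (dotr v b / sqn b) *: b.
Proof.
rewrite /prjmx mulmxBr mulmx1 -scalemxAr mulmxA [v *m b^T]mx11_scalar.
by rewrite mul_scalar_mx scalerA mulrC.
Qed.

Lemma prjmx_self n (b : 'rV[R]_n) : sqn b != 0 -> b *m prjmx b = 0.
Proof. by move=> h; rewrite mul_prjmx -sqnE divff // scale1r subrr. Qed.

Lemma sqn_pythag n (b v : 'rV[R]_n) : sqn b != 0 ->
  sqn v = sqn (v *m prjmx b) + (dotr v b / sqn b) ^+ 2 * sqn b.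
Proof.
move=> h; rewrite mul_prjmx -scaleNr [in RHS]sqnE !(dotrDl, dotrDr, dotrZl, dotrZr).
rewrite (dotrC b v) -!sqnE; field; exact: h.
Qed.

(** * Reduced bases *)

Lemma int_norm_lt1 (a : int) : `|a%:~R : R| < 1 -> a = 0.
Proof.
rewrite -intr_norm -[1]/(1%:~R) ltr_int => h.
by apply/eqP; rewrite -normr_eq0 eq_le normr_ge0 andbT -ltzD1 add0r.
Qed.

Lemma norm_le_sqr (x y : R) : 0 <= y -> x ^+ 2 <= y ^+ 2 -> `|x| <= y.
Proof. by move=> y0; rewrite -(real_normK (num_real x)) ler_pXn2r ?nnegrE. Qed.

Lemma toR_eq0 m n (A : 'M[int]_(m, n)) : (A^r == 0) = (A == 0).
Proof.
apply/eqP/eqP => [h|->]; last by rewrite map_mx0.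
apply/matrixP => i j; move/matrixP/(_ i j): h; rewrite !mxE.
by move/eqP; rewrite intr_eq0 => /eqP.
Qed.

(** A right inverse [A] of [B] recovers the coordinates [z] from the point [z B], so a very short
    point has integer coordinates of absolute value below 1. *)
Lemma lattice_discrete n m (B : 'M[R]_(n, m)) : row_free B ->
  exists2 d : R, 0 < d & forall z : 'rV[int]_n, z != 0 -> d <= sqn (z^r *m B).
Proof.
case/row_freeP => A BA.
pose a : R := 1 + \sum_k \sum_j `|A k j|.
have a_ge1 : 1 <= a by rewrite lerDl sumr_ge0// => k _; rewrite sumr_ge0.
have a_gt0 : 0 < a by lra.
exists (a^-1 ^+ 2); first by rewrite exprn_gt0 // invr_gt0.
move=> z; apply: contraNT; rewrite -ltNge => zB; apply/eqP/rowP => j.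
rewrite [RHS]mxE; apply: int_norm_lt1.
have -> : ((z 0 j)%:~R : R) = \sum_k (z^r *m B) 0 k * A k j.
  have : (z^r *m B *m A) 0 j = (z 0 j)%:~R by rewrite -mulmxA BA mulmx1 mxE.
  by rewrite mxE.
have hk k : `|(z^r *m B) 0 k| <= a^-1.
  apply: norm_le_sqr; first by rewrite invr_ge0 ltW.
  by apply: le_trans (ltW zB); rewrite le_sqn.
apply: le_lt_trans (ler_norm_sum _ _ _) _.
apply: (@le_lt_trans _ _ (\sum_k a^-1 * `|A k j|)).
  by apply: ler_sum => k _; rewrite normrM ler_wpM2r.
rewrite -mulr_sumr mulrC ltr_pdivrMr // mul1r /a.
suff : \sum_k `|A k j| <= \sum_k \sum_j `|A k j| by lra.
apply: ler_sum => k _; rewrite [leRHS](bigD1 j) //= lerDl sumr_ge0 //.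
Qed.

(* Stops within a factor 2 of the infimum, so that attainment is not an issue. *)
Lemma near_shortest n m (B : 'M[R]_(n.+1, m)) : row_free B ->
  exists2 z : 'rV[int]_n.+1, z != 0 &
    forall z' : 'rV[int]_n.+1, z' != 0 -> sqn (z^r *m B) <= 2 * sqn (z'^r *m B).
Proof.
move=> Bf; have [d d0 hd] := lattice_discrete Bf.
pose E := [set x : R | exists2 z : 'rV[int]_n.+1, z != 0 & x = sqn (z^r *m B)].
have Ed : lbound E d by move=> _ [z z0 ->]; exact: hd.
have E0 : E !=set0.
  exists (sqn ((const_mx 1 : 'rV[int]_n.+1)^r *m B)); exists (const_mx 1) => //.
  by apply/eqP => /rowP/(_ 0); rewrite !mxE => /eqP; rewrite oner_eq0.
have iE : has_inf E by split => //; exists d.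
have inf0 : 0 < inf E by apply: lt_le_trans d0 _; apply: lb_le_inf.
have [_ [z z0 ->] hz] := inf_adherent inf0 iE.
exists z => // z' z'0; apply: ltW; apply: lt_le_trans hz _.
have : inf E <= sqn (z'^r *m B) by apply: ge_inf; [exists d|exists z'].
lra.
Qed.

Lemma toR_unitmx n (U : 'M[int]_n) : U \in unitmx -> U^r \in unitmx.
Proof. by rewrite !unitmxE det_map_mx; apply: rmorph_unit. Qed.

(** The Smith form of the row [z] exhibits it as an integer multiple of the first row of a
    unimodular matrix; dividing by that nonzero integer only shortens the vector. *)
Lemma short_basis n m (B : 'M[R]_(n.+1, m)) : row_free B ->
  exists2 W : 'M[int]_(1 + n), W \in unitmx &
    forall z : 'rV[int]_n.+1, z != 0 ->
      sqn ((row 0 W)^r *m B) <= 2 * sqn (z^r *m B).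
Proof.
move=> Bf; have [z z0 hz] := near_shortest Bf.
have [L Lu [W Wu [d _ zE]]] := int_Smith_normal_form z.
exists W => // z' z'0; apply: le_trans (hz z' z'0).
pose a := L 0 0 * d`_0.
have zW : z = a *: row 0 W.
  rewrite zE [L]mx11_scalar mul_scalar_mx -scalemxAl /a -scalerA; congr (_ *: _).
  apply/rowP => j; rewrite !mxE (bigD1 ord0) //= !mxE /= mulr1n big1 ?addr0 //.
  move=> i i0; rewrite !mxE (_ : (_ == _) = false) ?mul0r //.
  by apply: contraNF i0 => /eqP h; apply/eqP/val_inj.
have a0 : a != 0 by apply: contra_neq z0 => a0; rewrite zW a0 scale0r.
have -> : z^r *m B = a%:~R *: ((row 0 W)^r *m B).
  by rewrite zW scalemxAl; congr (_ *m _); apply/matrixP => i j; rewrite !mxE intrM.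
rewrite sqnZ ler_peMl ?sqn_ge0 // -rmorphXn -[1]/(1%:~R) ler_int.
by rewrite -gtz0_ge1 lt_def sqr_ge0 andbT expf_eq0.
Qed.

Lemma round_shift (x : R) : exists k : int, (x + k%:~R) ^+ 2 <= 4^-1.
Proof.
exists (- Num.floor (x + 2^-1)).
have /andP [] := floor_itv (x + 2^-1); rewrite intrD intrN.
set f := (Num.floor _)%:~R => h1 h2.
have -> : (x - f) ^+ 2 = 4^-1 - (2^-1 - (x - f)) * (2^-1 + (x - f)) by field.
rewrite lerBlDr lerDl; apply: mulr_ge0; lra.
Qed.

Lemma row_unitmx_neq0 (K : comUnitRingType) n (U : 'M[K]_n) i :
  U \in unitmx -> row i U != 0.
Proof.
move=> Uu; apply/eqP => h; have := mulmxV Uu; move/matrixP/(_ i i).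
rewrite !mxE eqxx big1 => [/esym/eqP|j _]; first by rewrite oner_eq0.
by move/rowP/(_ j): h; rewrite !mxE => ->; rewrite mul0r.
Qed.

(** A relation between the projected rows becomes a relation between the rows of [G] after adding a
    suitable multiple of the first row. *)
Lemma row_free_prj n m (G : 'M[R]_(1 + n, m)) : row_free G ->
  sqn (usubmx G) != 0 -> row_free (dsubmx G *m prjmx (usubmx G)).
Proof.
move=> Gf b0; apply: inj_row_free => y; rewrite mulmxA mul_prjmx.
set t := _ / _ => h.
have : row_mx (- t%:M) y *m G == 0.
  by rewrite -[G]vsubmxK mul_row_col mulNmx mul_scalar_mx addrC h.
rewrite -(mul0mx _ G) => /eqP /(row_free_inj Gf) /eqP.
by rewrite -[X in _ == X]row_mx0 => /eqP /eq_row_mx [].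
Qed.

(* Take a nearly shortest vector b, reduce the projection of the lattice along b,
   and lift the basis obtained with b-components at most 1/2: near-minimality of
   b keeps every lifted vector at most twice as long as its projection in square. *)
Lemma reduced_basis n : exists2 C : R, 1 <= C &
  forall m (B : 'M[R]_(n, m)), row_free B ->
  exists2 U : 'M[int]_n, U \in unitmx & forall (z : 'rV[R]_n) j,
    z 0 j ^+ 2 * sqn (row j (U^r *m B)) <= C * sqn (z *m (U^r *m B)).
Proof.
elim: n => [|n [C C1 IH]].
  by exists 1 => // m B _; exists 1%:M; [exact: unitmx1|move=> z []].
have n1 : 1 <= n.+1%:R ^+ 2 :> R by rewrite -natrX ler1n expn_gt0.
exists (n.+1%:R ^+ 2 * (4 * C)).
  by rewrite -[1]mulr1; apply: ler_pM => //; lra.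
move=> m B Bf; have [W Wu hW] := short_basis Bf.
pose G0 : 'M[R]_(1 + n, m) := W^r *m B.
have G0f : row_free G0.
  by rewrite /row_free mxrankMfree // mxrank_unit // toR_unitmx.
pose b := usubmx G0; pose D := dsubmx G0.
have bE : b = (row 0 W)^r *m B.
  rewrite map_row -row_mul /b /G0; apply/rowP => k; rewrite !mxE.
  by apply: eq_bigr => l _; congr (W^r _ l * _); apply: val_inj.
have b0 : sqn b != 0.
  apply/eqP => /sqn_eq0 h; have := row_unitmx_neq0 0 Wu; case/negP.
  rewrite -toR_eq0; apply/eqP/(row_free_inj Bf).
  by rewrite mul0mx -bE.
have bp : 0 < sqn b by rewrite lt_def b0 sqn_ge0.
have [U' Uu' hU'] := IH _ _ (row_free_prj G0f b0).
rewrite -/b -/D in hU'.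
have [k hk] := fin_all_exists (fun j => round_shift (dotr (row j (U'^r *m D)) b / sqn b)).
pose K : 'cV[int]_n := \col_j k j.
pose S : 'M[int]_(1 + n) := block_mx 1%:M 0 K U'.
have Su : S \in unitmx by rewrite unitmxE det_lblock det1 mul1r -unitmxE.
have Uu : S *m W \in unitmx by rewrite unitmx_mul Su.
exists (S *m W) => //.
pose E := K^r *m b + U'^r *m D.
have GE : (S *m W)^r *m B = col_mx b E.
  rewrite map_mxM -mulmxA -/G0 -[G0]vsubmxK -/b -/D.
  by rewrite map_block_mx mul_block_col map_mx1 map_mx0 mul0mx addr0 mul1mx.
have EP : E *m prjmx b = U'^r *m (D *m prjmx b).
  by rewrite mulmxDl -!mulmxA prjmx_self // mulmx0 add0r.
have rE j : row j E = row j (U'^r *m D) + (k j)%:~R *: b.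
  by apply/rowP => l; rewrite /E addrC !mxE big_ord1 !mxE.
pose mu j := dotr (row j E) b / sqn b.
have mu4 j : mu j ^+ 2 <= 4^-1.
  by apply: le_trans (hk j); rewrite /mu rE dotrDl dotrZl -sqnE mulrDl mulfK.
pose c j := row j (U'^r *m (D *m prjmx b)).
have cE j : c j = row j E *m prjmx b by rewrite /c -EP row_mul.
have eE j : sqn (row j E) = sqn (c j) + mu j ^+ 2 * sqn b.
  by rewrite cE; apply: sqn_pythag.
have be j : sqn b <= 2 * sqn (row j E).
  rewrite bE; have -> : row j E = (row (rshift 1 j) (S *m W))^r *m B.
    by rewrite map_row -row_mul GE rowKd.
  by apply: hW; apply: row_unitmx_neq0.
(* Pythagoras with mu^2 <= 1/4 and |b|^2 <= 2 |e|^2 gives |e|^2 <= |c|^2 + |e|^2 / 2. *)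
have ec j : sqn (row j E) <= 2 * sqn (c j).
  have := eE j; have := be j; have := mu4 j; nra.
have bc j : sqn b <= 4 * sqn (c j) by have := be j; have := ec j; lra.
rewrite GE => z j; pose v := @mulmx R 1 (1 + n) m z (col_mx b E).
rewrite -[z *m _]/v.
pose z' := rsubmx (z : 'rV_(1 + n)); pose z0 := z 0 0.
have zE : z = row_mx (z0%:M) z'.
  rewrite -[LHS](@hsubmxK _ 1 1 n z); rewrite /z'.
  suff -> : lsubmx (z : 'rV_(1 + n)) = z0%:M by [].
  by rewrite [LHS]mx11_scalar; congr (_%:M); rewrite mxE; congr (z _ _); apply: val_inj.
have vE : v = z0 *: b + z' *m E by rewrite /v [in LHS]zE mul_row_col mul_scalar_mx.
have vP : v *m prjmx b = z' *m (U'^r *m (D *m prjmx b)).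
  by rewrite vE mulmxDl -scalemxAl prjmx_self // scaler0 add0r -mulmxA EP.
have := sqn_pythag v b0; rewrite vP; set t := dotr v b / _ => py.
have zc l : z' 0 l ^+ 2 * sqn (c l) <= C * sqn v.
  apply: le_trans (hU' z' l) _; rewrite ler_pM2l; last by lra.
  by rewrite py lerDl mulr_ge0 ?sqr_ge0 ?sqn_ge0.
have vp : 0 <= sqn v := sqn_ge0 v.
have -> : (n.+1%:R ^+ 2 * (4 * C)) * sqn v = n.+1%:R ^+ 2 * (4 * (C * sqn v)) by ring.
have CV : 0 <= C * sqn v by apply: mulr_ge0 => //; lra.
suff H (i : 'I_(1 + n)) : row_mx z0%:M z' 0 i ^+ 2 * sqn (row i (col_mx b E)) <=
    n.+1%:R ^+ 2 * (4 * (C * sqn v)) by rewrite zE; exact: H.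
case: (split_ordP i) => l ->; last first.
  rewrite rowKd row_mxEr.
  apply: (@le_trans _ _ (4 * (C * sqn v))); last by rewrite ler_peMl //; lra.
  have := zc l; have := ec l; have := sqr_ge0 (z' 0 l); nra.
rewrite ord1 rowKu row_id row_mxEl mxE eqxx mulr1n.
(* [ka] bounds the coordinates along the lifted vectors and the [b]-component [t] of [v]; the
   coordinate along [b] is [t] minus the contributions [z' l * mu l]. *)
pose ka := Num.sqrt (4 * (C * sqn v) / sqn b).
have ka0 : 0 <= ka by apply: sqrtr_ge0.
have ka2 : ka ^+ 2 = 4 * (C * sqn v) / sqn b.
  by rewrite sqr_sqrtr // divr_ge0 ?sqn_ge0 //; lra.
have zka l' : `|z' 0 l'| <= ka.
  apply: norm_le_sqr => //; rewrite ka2 ler_pdivlMr //.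
  have := zc l'; have := bc l'; have := sqr_ge0 (z' 0 l'); nra.
have tka : `|t| <= ka.
  apply: norm_le_sqr => //; rewrite ka2 ler_pdivlMr //.
  have := sqn_ge0 (z' *m (U'^r *m (D *m prjmx b))); nra.
have z0E : z0 = t - \sum_l z' 0 l * mu l.
  rewrite /t vE dotrDl dotrZl -sqnE mulrDl mulfK //.
  suff -> : dotr (z' *m E) b / sqn b = \sum_l z' 0 l * mu l by ring.
  rewrite mulmx_sum_row /mu.
  have -> : dotr (\sum_i z' 0 i *: row i E) b = \sum_i z' 0 i * dotr (row i E) b.
    elim/big_rec2 : _ => [|h x y _ <-]; first by rewrite /dotr mul0mx mxE.
    by rewrite dotrDl dotrZl.
  by rewrite mulr_suml; apply: eq_bigr => h _; rewrite mulrA.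
have z0ka : `|z0| <= n.+1%:R * ka.
  rewrite z0E; apply: le_trans (ler_normB _ _) _.
  rewrite mulrSr mulrDl mul1r addrC; apply: lerD => //.
  apply: le_trans (ler_norm_sum _ _ _) _.
  rewrite -[n in leRHS]card_ord -sum1_card natr_sum mulr_suml; apply: ler_sum => h _.
  rewrite normrM mul1r -[leRHS]mulr1 ler_pM //.
  by apply: norm_le_sqr => //; have := mu4 h; lra.
rewrite -ler_pdivlMr // -[leRHS]mulrA -ka2 -exprMn -[leLHS]real_normK ?num_real //.
by rewrite ler_pXn2r ?nnegrE // mulr_ge0.
Qed.

(** * Boxes and hyperplanes *)

Definition inbox n (N : 'I_n -> R) (z : 'rV[int]_n) : Prop :=
  forall j, `|(z 0 j)%:~R : R| <= N j.

Lemma unitmx_int_norm n (U : 'M[int]_n) : U \in unitmx -> `|(\det U)%:~R : R| = 1.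
Proof.
rewrite unitmxE => h.
have /orP[] := h : (\det U == 1) || (\det U == -1) => /eqP ->.
  by rewrite normr1.
by rewrite rmorphN1 normrN1.
Qed.

Lemma int_norm_ge1 (a : int) : a != 0 -> 1 <= `|a%:~R : R|.
Proof. by apply: contraNT; rewrite -ltNge => /int_norm_lt1 ->. Qed.

(* Applies [reduced_basis] to the lattice Z^n X^-1, in which the integer vector
   [z = t X] is the point [t]. *)
Lemma parallelepiped_in_box n : exists2 C : R, 1 <= C &
  forall X : 'M[int]_n, \det X != 0 -> exists (g : 'M[int]_n) (N : 'I_n -> R),
  [/\ g \in unitmx, forall j, 1 <= N j,
      \prod_j N j <= C * `|(\det X)%:~R| &
      forall (z : 'rV[int]_n) (t : 'rV[R]_n), z^r = t *m X^r ->
        (forall i, `|t 0 i| <= 1) -> inbox N (z *m g)].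
Proof.
have [C0 C01 RB] := reduced_basis n.
(* The squared length of [t] is at most [n]; using [n.+1] keeps the constant at least 1 when
   [n = 0]. *)
pose ka : R := C0 * n.+1%:R.
have nS1 : 1 <= n.+1%:R :> R by rewrite ler1n.
have ka1 : 1 <= ka by rewrite -[leLHS]mulr1 ler_pM.
exists (ka ^+ n * n`!%:R).
  by rewrite -[leLHS]mulr1 ler_pM ?exprn_ege1 // ler1n fact_gt0.
move=> X X0.
have Xu : X^r \in unitmx by rewrite unitmxE det_map_mx unitfE intr_eq0.
have Bf : row_free (invmx X^r) by rewrite row_free_unit unitmx_inv.
have [U Uu hU] := RB _ _ Bf; pose G := U^r *m invmx X^r.
have Gu : G \in unitmx by rewrite unitmx_mul toR_unitmx // unitmx_inv.
pose be j := Num.sqrt (sqn (row j G)).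
have be0 j : 0 < be j.
  rewrite sqrtr_gt0 lt_def sqn_ge0 andbT; apply/eqP => /sqn_eq0 /eqP.
  by apply/negP; apply: row_unitmx_neq0.
have key (z : 'rV[int]_n) (t : 'rV[R]_n) : z^r = t *m X^r ->
    (forall i, `|t 0 i| <= 1) -> forall j, `|((z *m invmx U) 0 j)%:~R : R| * be j <= ka.
  move=> zt t1 j; set y := z *m _.
  have yG : y^r *m G = t.
    by rewrite mulmxA -map_mxM mulmxKV // zt mulmxK.
  have := hU y^r j; rewrite -/G yG mxE => h.
  rewrite -[_ * _]ger0_norm; last by rewrite mulr_ge0 ?(ltW (be0 j)).
  apply: norm_le_sqr; first by lra.
  rewrite exprMn real_normK ?num_real // sqr_sqrtr ?sqn_ge0 //.
  apply: le_trans h _; rewrite /ka expr2 -mulrA ler_pM2l; last by lra.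
  apply: (@le_trans _ _ n%:R).
    rewrite -[n in leRHS]card_ord -sum1_card natr_sum; apply: ler_sum => i _.
    by rewrite -[leLHS]real_normK ?num_real // exprn_ile1.
  rewrite -[leLHS]mulr1; apply: ler_pM; rewrite ?ler_nat //.
exists (invmx U), (fun j => ka / be j); split.
- by rewrite unitmx_inv.
- move=> j; rewrite ler_pdivlMr // mul1r.
  (* Some row of [X] has a nonzero, integral [j]-th coordinate in the new basis, as [det X] is
     nonzero; [key] for that row then gives [be j <= ka]. *)
  have : exists i, (X *m invmx U) i j != 0.
    apply/existsP; apply: contraNT X0; rewrite negb_exists => /forallP h.
    have : \det (X *m invmx U) = 0.
      rewrite -det_tr (expand_det_row _ j) big1 // => i _.
      by have /negPn/eqP hi := h i; rewrite [_^T _ _]mxE hi mul0r.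
    move/eqP; rewrite det_mulmx mulf_eq0 => /orP[//|].
    have := Uu; rewrite -unitmx_inv unitmxE => /unitrP [a [_ ha]] /eqP h0.
    by move: ha; rewrite h0 mul0r => /eqP; rewrite eq_sym oner_eq0.
  case=> i /int_norm_ge1 hi.
  have := key (row i X) (delta_mx 0 i); rewrite -rowE map_row => /(_ erefl).
  have hd k : `|(delta_mx 0 i : 'rV[R]_n) 0 k| <= 1.
    by rewrite mxE eqxx /=; case: eqP; rewrite ?normr1 ?normr0 ?ler01.
  move=> /(_ hd j); rewrite -row_mul mxE; apply: le_trans.
  by rewrite ler_peMl // ltW.
- rewrite prodf_div prodr_const card_ord -mulrA ler_pM2l ?exprn_gt0 //; last by lra.
  have bp : 0 < \prod_j be j by apply: prodr_gt0.
  rewrite -div1r ler_pdivrMr //.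
  (* |det G| |det X| = 1, while |det G| is at most [n!] times the product of the row lengths. *)
  have : \det G * (\det X)%:~R = (\det U)%:~R :> R.
    by rewrite -!det_map_mx -det_mulmx /G mulmxKV.
  move/(congr1 Num.norm); rewrite normrM unitmx_int_norm // => e.
  rewrite -[leLHS]e mulrAC ler_wpM2r // -det_tr.
  apply: det_le => i j; rewrite mxE.
  rewrite /be -(sqrtr_sqr (G j i)) ler_sqrt ?sqn_ge0 //.
  by have := le_sqn (row j G) i; rewrite mxE.
- by move=> z t zt t1 j; rewrite ler_pdivlMr //; apply: (key z t).
Qed.

(** The norm [||w||] of the overview; its terms are nonnegative for [N >= 1], so the default 0 of
    the maximum is harmless. *)
Definition wnorm n (N : 'I_n -> R) (w : 'cV[int]_n) : R :=
  \big[Num.max/0]_j (`|(w j 0)%:~R| * N j).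

Lemma ler_prod_inj (I J : finType) (h : I -> J) (N : J -> R) :
  injective h -> (forall j, 1 <= N j) -> \prod_i N (h i) <= \prod_j N j.
Proof.
move=> hI N1.
have -> : \prod_i N (h i) = \prod_(j in codom h) N j.
  rewrite -big_uniq; last by rewrite map_inj_uniq ?enum_uniq.
  by rewrite /= big_map big_enum.
rewrite big_mkcond; apply: ler_prod => j _.
by case: ifP => _; rewrite ?lexx ?N1 ?ler01 ?(le_trans ler01 (N1 j)).
Qed.

(* [w] consists of the maximal minors of r + 1 columns of [Q], r of which are
   independent. *)
Lemma orth_cofactor r m (Q : 'M[int]_(r, m)) : row_free Q^r -> (r < m)%N ->
  exists w : 'cV[int]_m, [/\ w != 0, Q *m w = 0 &
    forall (Y : 'M[int]_r) (N : 'I_m -> R), (forall j, 1 <= N j) ->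
    (forall i, inbox N (row i (Y *m Q))) ->
    `|(\det Y)%:~R| * wnorm N w <= r`!%:R * \prod_j N j].
Proof.
move=> Qf rm.
have Qu : row_full (Q^r)^T by rewrite /row_full mxrank_tr.
(* [f] picks [r] independent columns of [Q], [j0] is a further column, and [h] lists all [r + 1] of
   them, [j0] first. *)
pose f := fullrankfun Qu.
have fI : injective f by exact: fullrankfun_inj.
have [j0 hj0] : exists j0, j0 \notin codom f.
  apply/existsP; apply: contraTT rm; rewrite negb_exists -leqNgt => /forallP h.
  have : (#|'I_m| <= #|codom f|)%N.
    by apply/subset_leq_card/fintype.subsetP => j _; have := h j; rewrite negbK.
  by rewrite (card_codom fI) !card_ord.
pose h (k : 'I_r.+1) := if unlift ord0 k is Some i then f i else j0.
have h0 : h ord0 = j0 by rewrite /h unlift_none.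
have hl i : h (lift ord0 i) = f i by rewrite /h liftK.
have hI : injective h.
  move=> a b; case: (unliftP ord0 a) => [a' ->|->]; case: (unliftP ord0 b) => [b' ->|->];
  rewrite ?h0 ?hl //.
  - by move=> /fI ->.
  - by move=> e; rewrite -e codom_f in hj0.
  - by move=> e; rewrite e codom_f in hj0.
pose Q' := colsub h Q.
pose u : 'cV[int]_r.+1 := \col_k ((-1) ^+ k * \det (col' k Q')).
(* Each entry of the product expands a determinant in which a row of [Q'] occurs twice. *)
have Qu0 : Q' *m u = 0.
  apply/colP => i; rewrite [RHS]mxE.
  pose M : 'M[int]_r.+1 := col_mx (row i Q') Q'.
  have M0 : M ord0 = row i Q' ord0.
    by apply/funext => k; rewrite /M -[RHS](col_mxEu (row i Q') Q' 0 k); congr (col_mx _ _ _ k); apply: val_inj.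
  have Ml a : M (lift ord0 a) = Q' a.
    by apply/funext => k; rewrite /M -[RHS](col_mxEd (row i Q') Q' a k); congr (col_mx _ _ _ k); apply: val_inj.
  have : \det M = 0.
    apply: (@determinant_alternate _ _ _ ord0 (lift ord0 i)); first exact: neq_lift.
    by move=> k; rewrite M0 Ml mxE.
  rewrite (expand_det_row _ ord0) => <-; rewrite mxE; apply: eq_bigr => k _.
  rewrite M0 !mxE /cofactor /= add0n; congr (_ * (_ * \det _)).
  by apply/matrixP => a b; rewrite 4!mxE Ml !mxE.
pose w := colsub h (1%:M : 'M[int]_m) *m u.
have wh k : w (h k) 0 = u k 0.
  rewrite mxE (bigD1 k) //= !mxE eqxx mul1r big1 ?addr0 // => l lk.
  by rewrite !mxE (inj_eq hI) eq_sym (negPf lk) mul0r.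
have wn j : j \notin codom h -> w j 0 = 0.
  move=> jh; rewrite mxE big1 // => l _; rewrite !mxE.
  by case: eqP => [e|_]; [rewrite e codom_f in jh|rewrite mul0r].
exists w; split.
- apply/eqP => w0.
  (* At [j0] the entry of [w] is the minor of the independent columns. *)
  have : u ord0 0 = 0 by rewrite -wh w0 mxE.
  rewrite mxE expr0 mul1r => /(congr1 (intmul (1 : R))).
  rewrite -det_map_mx => /eqP; rewrite -det_tr.
  suff -> : ((col' ord0 Q')^r)^T = rowsub f (Q^r)^T.
    by apply/negP; rewrite -unitfE -unitmxE; exact: fullrowsub_unit.
  by apply/matrixP => a b; rewrite !mxE hl.
- rewrite mulmxA; suff -> : Q *m colsub h 1%:M = Q' by [].
  by rewrite mulmx_colsub mulmx1.
move=> Y N N1 YN.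
have N0 j : 0 <= N j by apply: le_trans (N1 j).
have [r0 | /negPf r0] := boolP ((\det Y)%:~R == 0 :> R).
  by rewrite (eqP r0) normr0 mul0r mulr_ge0 // prodr_ge0.
rewrite mulrC -ler_pdivlMr ?normr_gt0 ?r0 //; apply: bigmax_le => [|j _].
  by rewrite divr_ge0 // mulr_ge0 // prodr_ge0.
rewrite ler_pdivlMr ?normr_gt0 ?r0 //.
have [/codomP [k ->]|/wn ->] := boolP (j \in codom h); last first.
  by rewrite normr0 !mul0r mulr_ge0 // prodr_ge0.
rewrite wh mxE rmorphM rmorphXn rmorphN1 normrM normrX normrN1 expr1n mul1r.
rewrite mulrAC -normrM -intrM [_ * \det Y]mulrC -det_mulmx -det_map_mx.
(* A minor of [Q] times [det Y] is a minor of [Y Q], whose rows lie in the box; the weight [N (h k)]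
   supplies the column omitted by the minor. *)
have : `|\det (Y *m col' k Q')^r| <= r`!%:R * \prod_a N (h (lift k a)).
  apply: det_le => a b; rewrite mxE; have := YN a (h (lift k b)).
  suff -> : (Y *m col' k Q') a b = row a (Y *m Q) 0 (h (lift k b)) by [].
  by rewrite !mxE; apply: eq_bigr => c _; rewrite !mxE.
move=> le1; apply: (le_trans (ler_wpM2r (N0 (h k)) le1)).
rewrite -mulrA ler_wpM2l //.
have -> : (\prod_a N (h (lift k a))) * N (h k) = \prod_a N (h a).
  by rewrite [RHS](bigD1_ord k) //= mulrC.
exact: ler_prod_inj.
Qed.

Lemma toR_inj m n (A B : 'M[int]_(m, n)) : A^r = B^r -> A = B.
Proof.
by move=> AB; apply/eqP; rewrite -subr_eq0 -toR_eq0 map_mxB AB subrr.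
Qed.

(** In the Smith form [V = L D W] only the first [r] columns of [D] can be nonzero, so a point of
    the real span of [V] has no coordinates in [W] beyond the first [r]; the coordinates are
    integers because [W] is unimodular. *)
Lemma saturated_basis r s (V : 'M[int]_(r, r + s)) :
  exists2 W : 'M[int]_(r + s), W \in unitmx &
    forall z : 'rV[int]_(r + s), (z^r <= V^r)%MS ->
    exists y : 'rV[int]_r, z = y *m usubmx W.
Proof.
have [L Lu [W Wu [d _ VE]]] := int_Smith_normal_form V.
exists W => // z /submxP [c zc].
pose D : 'M[int]_r := \matrix_(i, j) (d`_i *+ (i == j :> nat)).
have DE : \matrix_(i < r, j < r + s) (d`_i *+ (i == j :> nat)) = row_mx D 0.
  apply/matrixP => i j; case: (split_ordP j) => k ->; rewrite ?row_mxEl ?row_mxEr !mxE //.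
  by rewrite /= ltn_eqF // ltn_addr.
pose y := z *m invmx W.
have yE : y^r = row_mx (c *m L^r *m D^r) 0.
  rewrite map_mxM zc VE DE !map_mxM map_row_mx map_mx0 !mulmxA -[_ *m W^r *m _]mulmxA.
  by rewrite -map_mxM mulmxV // map_mx1 mulmx1 mul_mx_row mulmx0.
exists (lsubmx y); rewrite -[z](mulmxKV Wu) -/y.
rewrite -[in LHS](hsubmxK y) -[in LHS](vsubmxK W) mul_row_col.
suff -> : rsubmx y = 0 by rewrite mul0mx addr0.
by apply: toR_inj; rewrite map_rsubmx yE row_mxKr map_mx0.
Qed.

Lemma unitmx_row_free n (W : 'M[int]_n) : W \in unitmx -> row_free W^r.
Proof. by move=> Wu; rewrite row_free_unit toR_unitmx. Qed.

(** The new matrix is [Y] multiplied on the left by the identity with row [i] replaced by [t], which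
    has determinant [t i]. *)
Lemma cramer_int r (Y : 'M[int]_r) (y : 'rV[int]_r) (t : 'rV[R]_r) i :
  y^r = t *m Y^r ->
  (\det (\matrix_(a, b) if a == i then y 0 b else Y a b))%:~R = t 0 i * (\det Y)%:~R.
Proof.
move=> yt; set Z := matrix_of_fun _ _.
pose M : 'M[R]_r := \matrix_(a, b) if a == i then t 0 b else (a == b)%:R.
have ZM : Z^r = M *m Y^r.
  apply/matrixP => a b; rewrite !mxE; case: (eqVneq a i) => [ai|ai].
    move/matrixP/(_ 0 b): yt; rewrite !mxE => ->; apply: eq_bigr => c _.
    by rewrite !mxE ai eqxx.
  rewrite (bigD1 a) //= big1 ?addr0 => [|c ca]; rewrite !mxE (negPf ai).
    by rewrite eqxx mul1r.
  by rewrite eq_sym (negPf ca) mul0r.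
rewrite -!det_map_mx ZM det_mulmx; congr (_ * _).
rewrite (expand_det_col _ i) (bigD1 i) //= big1 ?addr0 => [|a ai]; last first.
  by rewrite mxE (negPf ai) mul0r.
rewrite mxE eqxx /cofactor -signr_odd addnn odd_double expr0 mul1r.
suff -> : row' i (col' i M) = 1%:M by rewrite det1 mulr1.
by apply/matrixP => a b; rewrite !mxE eq_sym (negPf (neq_lift _ _)) (inj_eq lift_inj).
Qed.

(* By Cramer's rule for a family [Y] of maximal determinant. *)
Lemma max_absdet r (P : 'rV[int]_r -> Prop) (K : R) :
  (forall Y : 'M[int]_r, (forall i, P (row i Y)) -> `|(\det Y)%:~R : R| <= K) ->
  forall Y0 : 'M[int]_r, (forall i, P (row i Y0)) -> \det Y0 != 0 ->
  exists Y : 'M[int]_r, [/\ forall i, P (row i Y), \det Y != 0 &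
    forall (y : 'rV[int]_r) (t : 'rV[R]_r), P y -> y^r = t *m Y^r ->
      forall i, `|t 0 i| <= 1].
Proof.
move=> hK Y0 PY0 Y00.
(* The absolute determinants are natural numbers bounded by [K], so one of them is maximal. *)
pose Q k := `[< exists Y : 'M[int]_r, (forall i, P (row i Y)) /\ `|\det Y|%N = k >].
have Q0 : exists k, Q k by exists `|\det Y0|%N; apply/asboolP; exists Y0.
have QK k : Q k -> (k <= Num.truncn K)%N.
  move=> /asboolP [Y [PY <-]].
  rewrite truncn_ge_nat; last by apply: le_trans (hK Y PY).
  by rewrite natr_absz intr_norm hK.
have [k /asboolP [Y [PY Yk]] kmax] := ex_maxnP Q0 QK.
have Yd0 : \det Y != 0.
  rewrite -absz_eq0 Yk; apply: contra_neq Y00 => k0; apply/eqP; rewrite -absz_eq0.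
  by rewrite -leqn0 -k0; apply: kmax; apply/asboolP; exists Y0.
exists Y; split => // y t Py yt i.
pose Z : 'M[int]_r := \matrix_(a, b) if a == i then y 0 b else Y a b.
have PZ a : P (row a Z).
  case: (eqVneq a i) => [->|ai].
    by rewrite (_ : row i Z = y) //; apply/rowP => b; rewrite !mxE eqxx.
  by rewrite (_ : row a Z = row a Y) //; apply/rowP => b; rewrite !mxE (negPf ai).
have : (`|\det Z| <= `|\det Y|)%N by rewrite Yk; apply: kmax; apply/asboolP; exists Z.
rewrite -(ler_nat R) !natr_absz !intr_norm (cramer_int _ yt) normrM.
by rewrite ger_pMl // normr_gt0 intr_eq0.
Qed.

(** Independent families have at most [m] members; one of maximal size spans, since a point outside
    its span could be added. *)
Lemma maximal_free_family m (S : 'rV[int]_m -> Prop) :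
  exists r (V : 'M[int]_(r, m)), [/\ row_free V^r, forall i, S (row i V) &
    forall z, S z -> (z^r <= V^r)%MS].
Proof.
pose Q k := `[< exists V : 'M[int]_(k, m), row_free V^r /\ forall i, S (row i V) >].
have Q0 : exists k, Q k.
  by exists 0; apply/asboolP; exists 0; split; [rewrite map_mx0 /row_free mxrank0|case].
have Qm k : Q k -> (k <= m)%N.
  by move=> /asboolP [V [Vf _]]; rewrite -(eqP Vf) rank_leq_col.
have [r /asboolP [V [Vf VS]] rmax] := ex_maxnP Q0 Qm.
exists r, V; split => // z Sz; apply: contraT => zV.
suff /rmax : Q r.+1 by rewrite ltnn.
suff : exists V' : 'M[int]_(1 + r, m), row_free V'^r /\ forall i, S (row i V').
  by move=> h; apply/asboolP.
exists (col_mx z V); split; last first.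
  move=> i; case: (split_ordP i) => j ->; first by rewrite rowKu ord1 row_id.
  by rewrite rowKd.
rewrite map_col_mx; apply: inj_row_free => v.
rewrite -[v]hsubmxK mul_row_col => vE.
have v0 : lsubmx v = 0.
  apply: contraNeq zV => v0; rewrite [lsubmx v]mx11_scalar in vE v0.
  have a0 : lsubmx v 0 0 != 0 by apply: contra_neq v0 => ->; rewrite raddf0.
  rewrite mul_scalar_mx in vE.
  rewrite -(eqmx_scale _ a0); apply/submxP; exists (- rsubmx v).
  by apply/eqP; rewrite mulNmx -addr_eq0 vE.
move: vE; rewrite v0 mul0mx add0r => /eqP; rewrite mulmx_free_eq0 // => /eqP ->.
by rewrite row_mx0.
Qed.

(* The box points orthogonal to [w] may span a space of dimension r < n.  They are
   then orthogonal to the vector [w'] of [orth_cofactor], and minimality of [w]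
   turns the bound on [wnorm N w'] into one on [wnorm N w]; the n - r missing
   directions are filled with unit vectors. *)
Lemma hyperplane_box n : exists2 C : R, 1 <= C &
  forall m (N : 'I_m -> R) (w : 'cV[int]_m) (z0 : 'rV[int]_m), m = n.+1 ->
  (forall j, 1 <= N j) -> inbox N z0 -> z0 *m w = 0 -> w != 0 ->
  (forall w' : 'cV[int]_m, w' != 0 -> z0 *m w' = 0 -> wnorm N w <= wnorm N w') ->
  exists (A : 'M[int]_(n, m)) (N' : 'I_n -> R),
  [/\ row_free A^r, forall j, 1 <= N' j,
      \prod_j N' j * wnorm N w <= C * \prod_j N j &
      forall z, inbox N z -> z *m w = 0 -> exists2 y, inbox N' y & z = y *m A].
Proof.
have [C C1 PB] := parallelepiped_in_box n.
exists (C * n`!%:R) => [|m N w z0 mn N1 z0N z0w w0 wmin].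
  by rewrite -[leLHS]mulr1 ler_pM // ler1n fact_gt0.
pose S z := inbox N z /\ z *m w = 0.
have [r [V [Vf VS Vmax]]] := maximal_free_family S.
have Vw : V *m w = 0.
  by apply/row_matrixP => i; rewrite row_mul row0; case: (VS i).
have rm : (r < m)%N.
  rewrite ltn_neqAle; apply/andP; split; last first.
    by move/eqP: (Vf) => <-; rewrite rank_leq_col.
  apply: contra_neqN w0 => /eqP rm; subst r.
  apply: toR_inj; rewrite map_mx0 -[LHS](@mulKmx R _ _ V^r); last by rewrite -row_free_unit.
  by rewrite -map_mxM Vw map_mx0 mulmx0.
pose e := (n - r)%N; have ne : n = (r + e)%N by rewrite /e; lia.
have me : m = (r + e.+1)%N by lia.
move: PB; clear mn; clearbody e; subst n m => PB {rm}.
have [W Wu Wz] := saturated_basis V.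
pose Q := usubmx W.
have Qf : row_free Q^r.
  apply: inj_row_free => v vQ.
  have : row_mx v 0 *m W^r == 0.
    by rewrite -[W]vsubmxK map_col_mx mul_row_col vQ mul0mx addr0.
  rewrite mulmx_free_eq0 ?unitmx_row_free // -[X in _ == X]row_mx0.
  by move=> /eqP /eq_row_mx [].
have SQ z : S z -> exists y, z = y *m Q by move=> /Vmax /Wz.
have [w' [w'0 Qw' w'b]] : exists w' : 'cV[int]_(r + e.+1), [/\ w' != 0, Q *m w' = 0 &
    forall Y : 'M[int]_r, (forall i, S (row i Y *m Q)) ->
    `|(\det Y)%:~R : R| * wnorm N w' <= r`!%:R * \prod_j N j].
  have [|w' [? ? h]] := orth_cofactor Qf; first by lia.
  exists w'; split => // Y YS; apply: h => // i.
  by rewrite row_mul; case: (YS i).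
have ww' : wnorm N w <= wnorm N w'.
  by apply: wmin => //; have [y ->] := SQ _ (conj z0N z0w); rewrite -mulmxA Qw' mulmx0.
have wb (Y : 'M[int]_r) : (forall i, S (row i Y *m Q)) ->
    `|(\det Y)%:~R : R| * wnorm N w <= r`!%:R * \prod_j N j.
  by move=> /w'b; apply: le_trans; rewrite ler_wpM2l.
have w1 : 1 <= wnorm N w.
  have [j wj] : exists j, w j 0 != 0.
    by apply/existsP; apply: contraNT w0; rewrite negb_exists => /forallP h;
      apply/eqP/colP => j; have /negPn/eqP -> := h j; rewrite mxE.
  apply: le_trans (le_bigmax _ _ j); rewrite -[leLHS]mulr1 ler_pM //.
  exact: int_norm_ge1.
have [Y0 Y0E] : exists Y0 : 'M[int]_r, V = Y0 *m Q.
  have [f hf] := fin_all_exists (fun i => SQ _ (VS i)).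
  exists (\matrix_i f i); apply/row_matrixP => i; rewrite row_mul rowK; exact: hf.
have Y0d : \det Y0 != 0.
  have : row_free Y0^r.
    by move: Vf; rewrite /row_free Y0E map_mxM mxrankMfree.
  by rewrite row_free_unit unitmxE det_map_mx unitfE intr_eq0.
(* [wnorm N w >= 1] turns [wb] into a bound on the determinants alone. *)
have [|i||Y [YS Yd Yt]] := @max_absdet r (fun y => S (y *m Q)) (r`!%:R * \prod_j N j) _ Y0.
- move=> Y /wb; apply: le_trans; rewrite ler_peMr //.
- by rewrite -row_mul -Y0E.
- exact: Y0d.
pose X : 'M[int]_(r + e) := block_mx Y 0 0 1%:M.
have dX : \det X = \det Y by rewrite /X det_ublock det1 mulr1.
have [|g [N' [gu N'1 N'p hg]]] := PB X; first by rewrite dX.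
(* [P] drops the last row of [W]; the points orthogonal to [w] already lie in the span of the first
   [r] rows. *)
pose P : 'M[int]_(r + e, r + e.+1) := pid_mx (r + e).
exists (invmx g *m (P *m W)), N'; split => //.
- rewrite !map_mxM /row_free mxrankMfree; last first.
    rewrite /row_free mxrankMfree ?unitmx_row_free // map_pid_mx.
    by rewrite rank_pid_mx // leq_add2l.
  by rewrite mxrank_unit // toR_unitmx // unitmx_inv.
- apply: (@le_trans _ _ (C * (`|(\det Y)%:~R| * wnorm N w))).
    by rewrite mulrA ler_wpM2r ?(le_trans ler01 w1) // -dX.
  rewrite -[leRHS]mulrA ler_wpM2l ?(le_trans ler01 C1) //.
  apply: le_trans (wb Y YS) _; rewrite ler_wpM2r ?prodr_ge0 // => [j _|].
    exact: le_trans (N1 j).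
  by rewrite ler_nat; apply: leq_fact; rewrite leq_addr.
move=> z zN zw; have [y zE] := SQ z (conj zN zw).
pose y' : 'rV[int]_(r + e) := row_mx y 0.
have Yu : Y^r \in unitmx by rewrite unitmxE det_map_mx unitfE intr_eq0.
pose t := y^r *m invmx Y^r.
have tY : y^r = t *m Y^r by rewrite mulmxKV.
exists (y' *m g).
  apply: (hg _ (row_mx t 0)) => [|i].
    by rewrite map_row_mx map_block_mx !map_mx0 mul_row_block -tY !mul0mx mulmx0 !addr0.
  case: (split_ordP i) => k ->; last by rewrite row_mxEr mxE normr0 ler01.
  by rewrite row_mxEl; apply: (Yt y) => //; rewrite -zE.
rewrite mulmxA mulmxK // zE mulmxA -[W in RHS]vsubmxK.
suff -> : y' *m P = row_mx y 0 by rewrite mul_row_col mul0mx addr0.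
apply/rowP => j; rewrite mxE big_split_ord /= [X in _ + X]big1 ?addr0 => [|k _]; last first.
  by rewrite row_mxEr mxE mul0r.
case: (split_ordP j) => l ->.
  rewrite (bigD1 l) //= big1 ?addr0 => [|k kl].
    rewrite !row_mxEl !mxE eqxx ltn_addr //=; exact: mulr1.
  by rewrite !mxE /= (_ : (_ == _) = (k == l)) // (negPf kl) mulr0.
rewrite row_mxEr big1 ?mxE // => k _; rewrite !mxE /=.
by rewrite ltn_eqF ?mulr0 // ltn_addr.
Qed.

(** * Coverings of a box *)

Lemma grid_enum n (L : 'I_n -> seq int) : exists s : seq {ffun 'I_n -> int},
  size s = (\prod_j size (L j))%N /\
  forall f : {ffun 'I_n -> int}, (forall j, f j \in L j) -> f \in s.
Proof.
pose D := {dffun forall j : 'I_n, 'I_(size (L j))}.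
pose F (d : D) : {ffun 'I_n -> int} := [ffun j => nth 0 (L j) (d j)].
exists [seq F d | d <- enum {: D}]; split.
  rewrite size_map -cardE card_dep_ffun foldrE big_map big_enum /=.
  by apply: eq_bigr => j _; rewrite card_ord.
move=> f hf; have hi j : (index (f j) (L j) < size (L j))%N by rewrite index_mem.
apply/mapP; exists (finfun (fun j => Ordinal (hi j)) : D); first by rewrite mem_enum.
by apply/ffunP => j; rewrite /F !ffunE /= nth_index.
Qed.

Definition int_itv (m : nat) : seq int := [seq k%:Z - m%:Z | k <- iota 0 (2 * m).+1].

Lemma size_int_itv m : size (int_itv m) = (2 * m).+1.
Proof. by rewrite size_map size_iota. Qed.

Lemma mem_int_itv m (a : int) : (`|a| <= m)%N -> a \in int_itv m.
Proof.
by move=> am; apply/mapP; exists `|(a + m%:Z)%R|%N; [rewrite mem_iota|]; lia.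
Qed.

Lemma absz_le_truncn (a : int) (x : R) : `|a%:~R| <= x -> (`|a| <= Num.truncn x)%N.
Proof.
move=> ax; rewrite truncn_ge_nat; first by rewrite natr_absz intr_norm.
exact: le_trans ax.
Qed.

Lemma size_int_itv_truncn (x : R) : 1 <= x ->
  (size (int_itv (Num.truncn x)))%:R <= 3 * x.
Proof.
move=> x1; rewrite size_int_itv -addn1 natrD natrM.
have /andP[] := truncn_itv (le_trans ler01 x1); lra.
Qed.

Lemma seq_argmin (X : eqType) (f : X -> R) (s : seq X) (x0 : X) : x0 \in s ->
  exists2 x, x \in s & forall y, y \in s -> f x <= f y.
Proof.
elim: s x0 => // a [|b s] IH x0 _.
  by exists a; [rewrite mem_head|move=> y; rewrite inE => /eqP ->].
have [x xs hx] := IH b (mem_head _ _).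
have [ax|xa] := leP (f a) (f x).
  exists a; first exact: mem_head.
  move=> y; rewrite inE => /orP[/eqP -> //|ys]; exact: le_trans (hx y ys).
exists x; first by rewrite inE xs orbT.
by move=> y; rewrite inE => /orP[/eqP -> |]; [exact: ltW|exact: hx].
Qed.

Lemma wnorm_ge n (N : 'I_n -> R) (w : 'cV[int]_n) j : `|(w j 0)%:~R| * N j <= wnorm N w.
Proof. exact: (le_bigmax 0 (fun j => `|(w j 0)%:~R| * N j) j). Qed.

Lemma wnorm_le n (N : 'I_n -> R) (w : 'cV[int]_n) x : 0 <= x ->
  (forall j, `|(w j 0)%:~R| * N j <= x) -> wnorm N w <= x.
Proof. by move=> x0 h; apply: bigmax_le. Qed.

(** Since [N >= 1], only finitely many integer vectors have norm at most [wnorm N w1]; a minimum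
    over the nonzero normals among them is a minimum over all. *)
Lemma shortest_normal n (N : 'I_n -> R) (z : 'rV[int]_n) (w1 : 'cV[int]_n) :
  (forall j, 1 <= N j) -> w1 != 0 -> z *m w1 = 0 ->
  exists w, [/\ w != 0, z *m w = 0, wnorm N w <= wnorm N w1 &
    forall w', w' != 0 -> z *m w' = 0 -> wnorm N w <= wnorm N w'].
Proof.
move=> N1 w10 zw1.
have [s [_ hs]] := grid_enum (fun _ : 'I_n => int_itv (Num.truncn (wnorm N w1))).
pose t := [seq w <- [seq \col_j (f : {ffun 'I_n -> int}) j | f <- s] | (w != 0) && (z *m w == 0)].
have ht w : w != 0 -> z *m w = 0 -> wnorm N w <= wnorm N w1 -> w \in t.
  move=> w0 zw ww; rewrite mem_filter w0 zw eqxx; apply/mapP.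
  exists [ffun j => w j 0]; last by apply/colP => j; rewrite !mxE ffunE.
  apply: hs => j; rewrite ffunE; apply: mem_int_itv; apply: absz_le_truncn.
  by apply: le_trans ww; apply: le_trans (wnorm_ge N w j); rewrite ler_peMr.
have w1t : w1 \in t by exact: ht.
have [w wt wmin] := seq_argmin (wnorm N) w1t.
move: (wt); rewrite mem_filter => /andP[/andP[w0 /eqP zw] _].
exists w; split => //; first exact: wmin.
move=> w' w'0 zw'; have [ww|/ltW ww] := leP (wnorm N w') (wnorm N w1).
  by apply: wmin; exact: ht.
by apply: le_trans ww; exact: wmin.
Qed.

(* Pigeonhole on the values of [z] on the nonnegative integer vectors [d] with
   [d j <= c T / N j]. *)
Lemma siegel n (N : 'I_n -> R) (T : R) (z : 'rV[int]_n) : (2 <= n)%N ->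
  (forall j, 1 <= N j) -> 1 <= T -> \prod_j N j <= T ^+ n.-1 -> inbox N z ->
  exists w : 'cV[int]_n, [/\ w != 0, z *m w = 0 & wnorm N w <= (2 * n + 2)%:R * T].
Proof.
move=> n2 N1 T1 NT zN; set c : R := (2 * n + 2)%:R.
have N0 j : 0 < N j by apply: lt_le_trans (N1 j).
have c1 : 1 <= c by rewrite ler1n; lia.
have cT1 : 1 <= c * T by rewrite -[leLHS]mulr1 ler_pM.
have cT0 : 0 <= c * T by lra.
pose M j := Num.truncn (c * T / N j).
have hM j := truncn_itv (divr_ge0 cT0 (ltW (N0 j))).
pose D := {dffun forall j : 'I_n, 'I_(M j).+1}.
pose K := Num.truncn (n%:R * (c * T)).
have hK := truncn_itv (mulr_ge0 (ler0n R n) cT0).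
pose v (d : D) : int := \sum_j z 0 j * (d j : nat)%:Z.
have vK d : (`|v d| <= K)%N.
  apply: absz_le_truncn; rewrite rmorph_sum /=; apply: le_trans (ler_norm_sum _ _ _) _.
  rewrite -[n in leRHS]card_ord -sum1_card natr_sum mulr_suml; apply: ler_sum => j _.
  rewrite mul1r rmorphM normrM; apply: (@le_trans _ _ (N j * (M j)%:R)).
    by apply: ler_pM => //; [exact: zN|rewrite ger0_norm // ler_nat -ltnS].
  by rewrite mulrC -ler_pdivlMr //; case/andP: (hM j).
pose u (d : D) : 'I_(2 * K).+1 := inord `|(v d + K%:Z)%R|%N.
have uv d d' : u d = u d' -> v d = v d'.
  move=> /(congr1 (@nat_of_ord _)); rewrite /u !inordK; have := vK d; have := vK d'; clear; lia.
have /injectivePn [d [d' dd' e]] : ~~ injectiveb u.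
  apply/negP => /injectiveP /leq_card; rewrite card_ord card_dep_ffun foldrE big_map big_enum /=.
  apply/negP; rewrite -ltnNge -(ltr_nat R) natr_prod.
  under eq_bigr do rewrite card_ord.
  (* There are at least c^n T vectors and at most 2 n c T + 1 values; [c = 2 n + 2] and [n >= 2]
     give c^n T >= c^2 T = 2 n c T + 2 c T. *)
  apply: (@lt_le_trans _ _ (\prod_j (c * T / N j))); last first.
    by apply: ler_prod => j _; case/andP: (hM j) => _ h; rewrite divr_ge0 ?(ltW (N0 j)) //= ltW.
  rewrite prodf_div prodr_const card_ord ltr_pdivlMr ?prodr_gt0 //.
  apply: (@le_lt_trans _ _ ((2 * K).+1%:R * T ^+ n.-1)).
    by rewrite ler_wpM2l.
  have -> : (c * T) ^+ n = (c ^+ n.-1 * c * T) * T ^+ n.-1.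
    by rewrite -{1}(prednK (ltnW n2)) exprS exprMn; ring.
  rewrite ltr_pM2r ?exprn_gt0 //; last by lra.
  rewrite -addn1 natrD natrM; case/andP: hK => hK _.
  have cE : c = 2 * n%:R + 2 by rewrite /c natrD natrM.
  have cc : c <= c ^+ n.-1 by rewrite -[leLHS]expr1 ler_weXn2l //; lia.
  apply: (@lt_le_trans _ _ (c * c * T)); last first.
    by rewrite -!mulrA; apply: ler_wpM2r.
  have : 2 * K%:R <= 2 * (n%:R * (c * T)) by rewrite ler_pM2l.
  have -> : c * c * T = 2 * (n%:R * (c * T)) + 2 * (c * T) by rewrite {1}cE; ring.
  lra.
exists (\col_j ((d j : nat)%:Z - (d' j : nat)%:Z)); split.
- apply: contra_neq dd' => /colP h; apply/ffunP => j; apply/val_inj.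
  by have := h j; rewrite !mxE => /eqP; rewrite subr_eq0 => /eqP []. 
- apply/rowP => i; rewrite ord1 !mxE; under eq_bigr do rewrite mxE mulrBr.
  by rewrite sumrB -/(v d) -/(v d') (uv _ _ e) subrr.
apply: wnorm_le => // j; rewrite mxE -ler_pdivlMr //.
apply: (@le_trans _ _ (M j)%:R); last by case/andP: (hM j).
rewrite -intr_norm [leRHS]pmulrn ler_int.
have := ltn_ord (d j); have := ltn_ord (d' j); clear; lia.
Qed.

(** Subspaces of dimension [k] are row spaces of square real matrices; the bound on their number is
    real so that it can be a multiple of a power of [T]. *)
Definition covered n (k : nat) (S : 'rV[int]_n -> Prop) (M : R) : Prop :=
  exists s : seq 'M[R]_n, [/\ forall U, U \in s -> \rank U = k,
    forall z, S z -> exists2 U, U \in s & (z^r <= U)%MS & (size s)%:R <= M].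

Lemma covered_le n k (S S' : 'rV[int]_n -> Prop) (M M' : R) :
  (forall z, S' z -> S z) -> M <= M' -> covered k S M -> covered k S' M'.
Proof.
move=> SS MM [s [h1 h2 h3]]; exists s; split=> //; last exact: le_trans MM.
by move=> z /SS /h2.
Qed.

Lemma covered_full n (S : 'rV[int]_n -> Prop) : covered n S 1.
Proof.
exists [:: 1%:M]; split => //.
  by move=> U; rewrite inE => /eqP ->; rewrite mxrank1.
by move=> z _; exists 1%:M; [rewrite inE|rewrite submx1].
Qed.

(** The empty set needs no subspace, so a point of the set may be assumed; [covered_by_hyperplanes]
    thus gets the [z0] that [hyperplane_box] asks for. *)
Lemma covered_witness n k (S : 'rV[int]_n -> Prop) (M : R) : 0 <= M ->
  (forall z, S z -> covered k S M) -> covered k S M.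
Proof.
move=> M0 h; have [[z Sz]|nS] := pselect (exists z, S z); first exact: h Sz.
exists [::]; split => // z Sz; exfalso; apply: nS; by exists z.
Qed.

Lemma covered_bigcup n k (X : eqType) (s : seq X) (S : X -> 'rV[int]_n -> Prop)
    (M : X -> R) : (forall x, x \in s -> covered k (S x) (M x)) ->
  covered k (fun z => exists2 x, x \in s & S x z) (\sum_(x <- s) M x).
Proof.
elim: s => [|x s IH] h; first by exists [::]; split; rewrite ?big_nil // => z [].
have [t [t1 t2 t3]] := h x (mem_head _ _).
have [|u [u1 u2 u3]] := IH; first by move=> y ys; apply: h; rewrite inE ys orbT.
exists (t ++ u); split.
- by move=> U; rewrite mem_cat => /orP[/t1|/u1].
- move=> z [y]; rewrite inE => /orP[/eqP -> /t2|ys Sy].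
    by case=> U Ut zU; exists U => //; rewrite mem_cat Ut.
  by have [|U Ut zU] := u2 z; [exists y|exists U => //; rewrite mem_cat Ut orbT].
- by rewrite size_cat natrD big_cons lerD.
Qed.

Lemma covered_image n p k (A : 'M[int]_(p, n)) (S : 'rV[int]_n -> Prop)
    (S' : 'rV[int]_p -> Prop) (M : R) : row_free A^r ->
  (forall z, S z -> exists2 y, S' y & z = y *m A) ->
  covered k S' M -> covered k S M.
Proof.
move=> Af SS [s [h1 h2 h3]]; exists [seq <<U *m A^r>>%MS | U <- s]; split.
- by move=> _ /mapP [U Us ->]; rewrite mxrank_gen mxrankMfree // h1.
- move=> z /SS [y Sy ->]; have [U Us yU] := h2 _ Sy.
  exists <<U *m A^r>>%MS; first exact: map_f.
  by rewrite genmxE map_mxM submxMr.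
- by rewrite size_map.
Qed.

(** Preimages under a surjective map keep their codimension; the preimage of [U] is the kernel of
    [A] followed by the quotient by [U]. *)
Lemma covered_preimage n p k (A : 'M[int]_(n, p)) (S : 'rV[int]_n -> Prop)
    (S' : 'rV[int]_p -> Prop) (M : R) : row_full A^r -> (k <= p)%N ->
  (forall z, S z -> S' (z *m A)) ->
  covered k S' M -> covered (n - p + k) S M.
Proof.
move=> Af kp SS [s [h1 h2 h3]]; exists [seq kermx (A^r *m cokermx U) | U <- s].
have pn : (p <= n)%N by move/eqP: (Af) => <-; rewrite rank_leq_row.
split.
- move=> _ /mapP [U Us ->]; rewrite mxrank_ker (eqmxMfull _ Af) mxrank_coker h1 //.
  by lia.
- move=> z /SS Sz; have [U Us yU] := h2 _ Sz.
  exists (kermx (A^r *m cokermx U)); first exact: map_f.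
  by apply/sub_kermxP; rewrite mulmxA -map_mxM; apply/eqP; rewrite -submxE.
- by rewrite size_map.
Qed.

(** One line for each point of the box; the origin, which spans no line, is assigned the first
    coordinate axis. *)
Lemma covered_by_lines n (N : 'I_n -> R) : (0 < n)%N -> (forall j, 1 <= N j) ->
  covered 1 (inbox N) (3 ^+ n * \prod_j N j).
Proof.
move=> n0 N1.
have [s [ss hs]] := grid_enum (fun j => int_itv (Num.truncn (N j))).
pose i0 : 'I_n := Ordinal n0.
pose v (f : {ffun 'I_n -> int}) : 'rV[R]_n :=
  if [forall j, f j == 0] then delta_mx 0 i0 else \row_j (f j)%:~R.
exists [seq <<v f>>%MS | f <- s]; split.
- move=> _ /mapP [f _ ->]; rewrite mxrank_gen /v; case: forallP => [_|h].
    by rewrite mxrank_delta.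
  apply/eqP; rewrite rank_rV eqb1; apply/eqP => /rowP f0; apply: h => j.
  by have := f0 j; rewrite !mxE => /eqP; rewrite intr_eq0.
- move=> z zN; pose f := [ffun j => z 0 j].
  exists <<v f>>%MS.
    apply: map_f; apply: hs => j; rewrite ffunE.
    by apply: mem_int_itv; apply: absz_le_truncn; exact: zN.
  rewrite genmxE /v; case: forallP => [h|_].
    suff -> : z^r = 0 by rewrite sub0mx.
    by apply/rowP => j; have := h j; rewrite ffunE !mxE => /eqP ->.
  by suff -> : \row_j (f j)%:~R = z^r by []; apply/rowP => j; rewrite !mxE ffunE.
- rewrite size_map ss natr_prod -[n in 3 ^+ n]card_ord -prodr_const -big_split /=.
  by apply: ler_prod => j _; rewrite ler0n size_int_itv_truncn.
Qed.

(** * Real roots and the induction on the dimension *)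

Definition rootr (m : nat) (x : R) : R := x `^ (m%:R^-1).

Lemma rootr_ge0 m x : 0 <= rootr m x. Proof. exact: powR_ge0. Qed.

Lemma rootrK m x : (0 < m)%N -> 0 <= x -> rootr m x ^+ m = x.
Proof.
move=> m0 x0; rewrite -powR_mulrn ?rootr_ge0 // -powRrM mulVf ?powRr1 //.
by rewrite pnatr_eq0 -lt0n.
Qed.

Lemma ler_rootr m x y : (0 < m)%N -> 0 <= x -> x <= y -> rootr m x <= rootr m y.
Proof.
move=> m0 x0 xy; rewrite -(@ler_pXn2r _ m) ?nnegrE ?rootr_ge0 //.
by rewrite !rootrK // (le_trans x0).
Qed.

Lemma ler1_rootr m x : (0 < m)%N -> 1 <= x -> 1 <= rootr m x.
Proof.
move=> m0 x1; rewrite -(@ler_pXn2r _ m) ?nnegrE ?rootr_ge0 //.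
by rewrite expr1n rootrK // (le_trans ler01).
Qed.

(* Telescoping against [a ^ (1/m) - (a - 1) ^ (1/m) >= a ^ (1/m - 1) / m]. *)
Lemma sum_rootr (m A : nat) (Y : R) : (0 < m)%N -> 0 <= Y -> A%:R <= Y ->
  \sum_(1 <= a < A.+1) rootr m (Y / a%:R) ^+ m.-1 <= m%:R * Y.
Proof.
move=> m0 Y0 AY; rewrite big_add1 /=.
set y := rootr m Y; have y0 : 0 <= y by exact: rootr_ge0.
have yY : y ^+ m = Y by exact: rootrK.
pose x a := rootr m (a%:R : R).
have x0 a : 0 <= x a by exact: rootr_ge0.
have xK a : x a ^+ m = a%:R by exact: rootrK.
apply: (@le_trans _ _ (\sum_(0 <= a < A) m%:R * y ^+ m.-1 * (x a.+1 - x a))).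
  apply: ler_sum => a _.
  have p1 : 1 <= x a.+1 by apply: ler1_rootr => //; rewrite ler1n.
  have p0 : 0 < x a.+1 by lra.
  have qp : x a <= x a.+1 by apply: ler_rootr => //; rewrite ler_nat.
  have -> : rootr m (Y / a.+1%:R) = y / x a.+1.
    apply/eqP; rewrite -(@eqrXn2 _ m) ?rootr_ge0 // ?divr_ge0 ?rootr_ge0 //.
    by rewrite exprMn exprVn yY xK rootrK // divr_ge0.
  rewrite exprMn exprVn [m%:R * _]mulrC -mulrA ler_wpM2l ?exprn_ge0 //.
  rewrite -div1r ler_pdivrMr ?exprn_gt0 //.
  (* That is, 1 = p^m - q^m <= m p^(m-1) (p - q) with p, q the [m]-th roots of [a + 1] and [a]. *)
  suff key : 1 <= m%:R * x a.+1 ^+ m.-1 * (x a.+1 - x a).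
    by apply: le_trans key _; rewrite le_eqVlt; apply/orP; left; apply/eqP; ring.
  have e1 : x a.+1 ^+ m - x a ^+ m = 1 by rewrite !xK -natrB // subSnn.
  rewrite -[leLHS]e1 subrXX mulrC ler_wpM2r ?subr_ge0 //.
  have -> : m%:R * x a.+1 ^+ m.-1 = \sum_(i < m) x a.+1 ^+ m.-1.
    by rewrite sumr_const card_ord mulr_natl.
  apply: ler_sum => i _.
  apply: (@le_trans _ _ (x a.+1 ^+ (m.-1 - i) * x a.+1 ^+ i)).
    by rewrite ler_wpM2l ?exprn_ge0 // lerXn2r ?nnegrE.
  by rewrite -exprD subnK //; have := ltn_ord i; lia.
rewrite -mulr_sumr telescope_sumr // -mulrA ler_wpM2l //.
rewrite -[in leRHS]yY -[in leRHS](prednK m0) exprSr ler_wpM2l ?exprn_ge0 //.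
by have := ler_rootr m0 (ler0n R A) AY; have := x0 0%N; rewrite /x /y; lra.
Qed.

Lemma wnorm_attained n (N : 'I_n.+1 -> R) (w : 'cV[int]_n.+1) : (forall j, 1 <= N j) ->
  exists i, wnorm N w = `|(w i 0)%:~R| * N i.
Proof.
move=> N1; eexists; apply: (bigmax_eq_arg _ ord0) => // j _.
by rewrite mulr_ge0 // (le_trans ler01).
Qed.

(* The shortest normals are grouped by a coordinate [i] realizing [wnorm N w] and by
   [a = |w i|]: there are O(N i) of them in each group, and the sum over [a] is
   [sum_rootr]. *)
Lemma covered_by_hyperplanes n c (C' : R) : (0 < c < n)%N -> 0 <= C' ->
  (forall (N : 'I_n -> R) T, (forall j, 1 <= N j) -> 1 <= T ->
    \prod_j N j <= T ^+ n.-1 -> covered (n - c.-1) (inbox N) (C' * T ^+ c.-1)) ->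
  exists2 C : R, 0 <= C & forall (N : 'I_n.+1 -> R) T,
    (forall j, 1 <= N j) -> 1 <= T -> \prod_j N j = T ^+ n -> (forall j, N j <= T) ->
    covered (n.+1 - c) (inbox N) (C * T ^+ c).
Proof.
move=> /andP[c0 cn] C'0 IH.
have [K K1 hyp] := hyperplane_box n.
pose c1 : R := (2 * n.+1 + 2)%:R.
have c1_1 : 1 <= c1 by rewrite ler1n; lia.
have K0 : 0 < K by lra.
pose m := n.-1.
have m0 : (0 < m)%N by rewrite /m; clear -c0 cn; lia.
(* The three factors come from the number of normals in a group, the induction bound, and the sum
   over [a]. *)
pose C2 : R := 2 * (3 * c1) ^+ n * (C' * K ^+ c.-1) * (m%:R * c1).
have C20 : 0 <= C2 by rewrite /C2 !mulr_ge0 ?exprn_ge0 ?mulr_ge0 //; lra.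
exists (n.+1%:R * C2); first by rewrite mulr_ge0.
(* By [siegel], shortest normals of box points have norm at most [Z]. *)
move=> N T N1 T1 NT NleT; set Z := c1 * T.
have N0 j : 0 < N j by apply: lt_le_trans (N1 j).
have T0 : 0 < T by lra.
have Tn : T ^+ n = T ^+ m * T by rewrite -exprSr /m prednK // (ltn_trans c0).
have TZ : T <= Z by rewrite ler_peMl // ltW.
have Z0 : 0 < Z by lra.
have ZN j : 1 <= Z / N j by rewrite ler_pdivlMr // mul1r (le_trans (NleT j)).
pose A i := Num.truncn (Z / N i).
have hA i := truncn_itv (le_trans ler01 (ZN i)).
(* Candidates for the normals of group [(i, a)]: coordinate [i] is [a] or [-a], the others satisfy
   [|w j| <= Z / N j]. *)
pose L i a : 'I_n.+1 -> seq int := fun j =>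
  if j == i then [:: a%:Z; - a%:Z] else int_itv (A j).
have [G hG] := choice (fun ia : 'I_n.+1 * nat => grid_enum (L ia.1 ia.2)).
pose S i a (f : {ffun 'I_n.+1 -> int}) (z : 'rV[int]_n.+1) :=
  let w : 'cV[int]_n.+1 := \col_j f j in
  [/\ inbox N z, z *m w = 0, w != 0, wnorm N w = a%:R * N i &
    forall w' : 'cV[int]_n.+1, w' != 0 -> z *m w' = 0 -> wnorm N w <= wnorm N w'].
(* [K * T * rho i a] is the parameter for the induction: its power [n - 1] dominates the volume of
   the box [N']. With [Z] in place of [T], [rho >= 1] for all [a <= A i]. *)
pose rho i a := rootr m (Z / N i / a%:R).
pose B i a : R := C' * (K * T) ^+ c.-1 * rho i a ^+ m.-1.
have KT : 0 <= K * T by rewrite mulr_ge0; lra.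
have B0 i a : 0 <= B i a.
  by rewrite mulr_ge0 ?exprn_ge0 ?rootr_ge0 // mulr_ge0 // exprn_ge0.
have covS i a f : (1 <= a <= A i)%N -> covered (n.+1 - c) (S i a f) (B i a).
  move=> /andP[a1 aA]; apply: covered_witness => // z0 [z0N z0w w0 wE wmin].
  have [D [N' [Df N'1 N'p hD]]] := hyp _ _ _ _ erefl N1 z0N z0w w0 wmin.
  have ap : 0 < a%:R :> R by rewrite ltr0n.
  have aZ : a%:R <= Z / N i.
    by apply: (@le_trans _ _ (A i)%:R); [rewrite ler_nat|case/andP: (hA i)].
  have rho1 : 1 <= rho i a by apply: ler1_rootr => //; rewrite ler_pdivlMr // mul1r.
  have rhoK : rho i a ^+ m = Z / N i / a%:R.
    by rewrite rootrK // !divr_ge0 ?ltW.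
  have T'1 : 1 <= K * T * rho i a by rewrite -[leLHS]mulr1 ler_pM // -[leLHS]mulr1 ler_pM.
  have T'p : \prod_j N' j <= (K * T * rho i a) ^+ n.-1.
    rewrite -/m !exprMn rhoK.
    have h1 : \prod_j N' j <= K * T ^+ n / (a%:R * N i).
      by rewrite ler_pdivlMr ?mulr_gt0 // -wE -NT.
    apply: le_trans h1 _.
    rewrite Tn.
    have -> : K * (T ^+ m * T) / (a%:R * N i) = K * T ^+ m * (T / N i / a%:R).
      by field; rewrite !gt_eqF.
    have KK : K <= K ^+ m by rewrite -[leLHS]expr1 ler_weXn2l.
    apply: ler_pM.
    - by rewrite mulr_ge0 ?exprn_ge0 // ltW.
    - by rewrite !divr_ge0 // ltW.
    - by rewrite ler_wpM2r // exprn_ge0 // ltW.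
    - by rewrite !ler_pM2r ?invr_gt0.
  have imS z : S i a f z -> exists2 y, inbox N' y & z = y *m D.
    by move=> [zN zw _ _ _]; exact: hD.
  have -> : (n.+1 - c = n - c.-1)%N by clear -c0; lia.
  apply: (covered_le _ _ (covered_image Df imS (IH _ _ N'1 T'1 T'p))) => //.
  (* The power [c - 1] of [rho] is raised to [m - 1], the exponent of [sum_rootr]; this uses
     [c <= m] and [rho >= 1]. *)
  rewrite exprMn mulrA ler_wpM2l //.
    by rewrite mulr_ge0 ?exprn_ge0.
  by rewrite ler_weXn2l // /m; clear -cn c0; lia.
pose X := [seq (i, a) | i <- enum 'I_n.+1, a <- index_iota 1 (A i).+1].
have covX : forall ia, ia \in X -> covered (n.+1 - c)
    (fun z => exists2 f, f \in G ia & S ia.1 ia.2 f z) ((size (G ia))%:R * B ia.1 ia.2).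
  move=> ia /allpairsPdep [i [a [_ aA ->]]] /=.
  have -> : (size (G (i, a)))%:R * B i a = \sum_(f <- G (i, a)) B i a.
    by rewrite big_const_seq count_predT iter_addr_0 mulr_natl.
  apply: covered_bigcup => f _; apply: covS.
  by move: aA; rewrite mem_index_iota ltnS.
apply: (covered_le _ _ (covered_bigcup covX)) => [z zN|].
  have n2 : (2 <= n.+1)%N by clear -c0 cn; lia.
  have NT' : \prod_j N j <= T ^+ n.+1.-1 by rewrite NT.
  have [w1 [w10 zw1 w1Z]] := siegel n2 N1 T1 NT' zN.
  have [w [w0 zw ww wmin]] := shortest_normal N1 w10 zw1.
  have wZ : wnorm N w <= Z := le_trans ww w1Z.
  have [i wi] := wnorm_attained w N1.
  pose a := `|w i 0%R|%N.
  have aE : wnorm N w = a%:R * N i by rewrite wi natr_absz intr_norm.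
  have a1 : (0 < a)%N.
    rewrite lt0n; apply: contra_neqN w0 => /eqP a0.
    apply/colP => j; rewrite mxE; apply: int_norm_lt1.
    apply: (@le_lt_trans _ _ 0) => //; rewrite -(pmulr_lle0 _ (N0 j)).
    by apply: le_trans (wnorm_ge N w j) _; rewrite aE a0 mul0r.
  have wA j : (`|w j 0%R| <= A j)%N.
    apply: absz_le_truncn; rewrite ler_pdivlMr //.
    exact: le_trans (wnorm_ge N w j) wZ.
  pose f := [ffun j => w j 0].
  have fw : \col_j f j = w by apply/colP => j; rewrite mxE ffunE.
  exists (i, a).
    by apply/allpairsPdep; exists i, a; rewrite mem_enum mem_index_iota a1 ltnS wA.
  exists f; last by rewrite /S /= fw.
  have [_ hf] := hG (i, a); apply: hf => j; rewrite ffunE /L /=.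
  case: eqP => [->|_]; last exact: mem_int_itv.
  by rewrite !inE /a; case: (w i 0) => k; rewrite ?NegzE /= ?abszN eqxx ?orbT.
(* As [prod N = T ^ n], the product of [3 Z / N j] over [j != i] is [(3 c1) ^ n * N i]. *)
have sizeG i a : (size (G (i, a)))%:R <= 2 * (3 * c1) ^+ n * N i.
  have [-> _] := hG (i, a); rewrite /= natr_prod (bigD1 i) //= {1}/L eqxx /= -!mulrA ler_pM2l //.
  set P := \prod_(j | j != i) N j.
  have P0 : 0 < P by apply: prodr_gt0.
  have NP : T ^+ n = N i * P by rewrite -NT (bigD1 i).
  apply: (@le_trans _ _ (\prod_(j | j != i) (3 * Z / N j))).
    apply: ler_prod => j ji; rewrite ler0n /= /L (negPf ji) -mulrA.
    exact: size_int_itv_truncn.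
  have -> : \prod_(j | j != i) (3 * Z / N j) = (3 * Z) ^+ n / P.
    by rewrite prodf_div prodr_const cardC1 card_ord.
  by rewrite ler_pdivrMr // /Z mulrA exprMn NP mulrA.
rewrite big_allpairs_dep /= big_enum /=.
have -> : n.+1%:R * C2 * T ^+ c = \sum_(i < n.+1) C2 * T ^+ c.
  by rewrite sumr_const card_ord -mulrA mulr_natl.
apply: ler_sum => i _.
apply: (@le_trans _ _ (\sum_(1 <= a < (A i).+1) (2 * (3 * c1) ^+ n * N i) *
    (C' * (K * T) ^+ c.-1) * rho i a ^+ m.-1)).
  by apply: ler_sum => a _; rewrite -[leRHS]mulrA ler_wpM2r.
rewrite -mulr_sumr.
have AZ : (A i)%:R <= Z / N i by case/andP: (hA i).
have cNi : 0 <= 2 * (3 * c1) ^+ n * N i * (C' * (K * T) ^+ c.-1).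
  by rewrite !mulr_ge0 ?exprn_ge0 ?(ltW (N0 i)) //; lra.
(* The sum over [a] is at most [m Z / N i], cancelling the factor [N i] from the number of
   normals. *)
apply: le_trans (ler_wpM2l cNi (sum_rootr m0 (le_trans ler01 (ZN i)) AZ)) _.
have -> : T ^+ c = T ^+ c.-1 * T by rewrite -exprSr prednK.
rewrite /Z /C2 !exprMn le_eqVlt; apply/orP; left.
by apply/eqP; field; rewrite gt_eqF.
Qed.

Lemma covered_drop_coordinate n k (j : 'I_n.+1) (N : 'I_n.+1 -> R) (M : R) :
  (k <= n)%N -> covered k (inbox (fun i => N (lift j i))) M ->
  covered k.+1 (inbox N) M.
Proof.
move=> kn h; rewrite -[k.+1]add1n -[1%N](subSnn n).
apply: (covered_preimage (A := col' j 1%:M) _ kn _ h).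
  rewrite -col_leq_rank -mxrank_tr.
  have : row_free (row' j (1%:M : 'M[R]_n.+1)).
    apply/row_freeP; exists (col' j 1%:M); apply/matrixP => a b.
    rewrite !mxE (bigD1 (lift j a)) //= !mxE eqxx mul1r (inj_eq lift_inj) big1 ?addr0 //.
    by move=> l la; rewrite !mxE eq_sym (negPf la) mul0r.
  rewrite /row_free => /eqP {1}<-; rewrite (_ : row' j _ = ((col' j 1%:M)^r)^T) //.
  by apply/matrixP => a b; rewrite !mxE eq_sym; case: eqP.
move=> z zN i; rewrite (_ : (z *m _) 0 i = z 0 (lift j i)); first exact: zN.
rewrite mxE (bigD1 (lift j i)) //= !mxE eqxx mulr1 big1 ?addr0 // => l li.
by rewrite !mxE (negPf li) mulr0.
Qed.

Lemma covered_box n c : (c < n)%N -> exists2 C : R, 0 <= C &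
  forall (N : 'I_n -> R) (T : R), (forall j, 1 <= N j) -> 1 <= T ->
  \prod_j N j <= T ^+ n.-1 -> covered (n - c) (inbox N) (C * T ^+ c).
Proof.
elim: n c => // n IH c; rewrite ltnS leq_eqVlt => /predU1P [->|cn].
  exists (3 ^+ n.+1) => [|N T N1 T1 NT]; first exact: exprn_ge0.
  rewrite subSnn; apply: covered_le (covered_by_lines _ N1) => //.
  by rewrite ler_wpM2l // exprn_ge0.
have [->|c0] := posnP c.
  exists 1 => // N T _ _ _; rewrite expr0 mulr1 subn0; exact: covered_full.
have [CA CA0 hA] := IH c cn.
have [C' C'0 hC'] := IH c.-1 (leq_ltn_trans (leq_pred c) cn).
have [|CB CB0 hB] := @covered_by_hyperplanes n c C' _ C'0 hC'; first by rewrite c0.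
exists (CA + CB) => [|N T N1 T1 NT]; first by rewrite addr_ge0.
have n0 : (0 < n)%N by apply: leq_ltn_trans cn.
have N0 j : 0 < N j by apply: lt_le_trans (N1 j).
have P1 : 1 <= \prod_j N j.
  by apply: (big_ind (fun x : R => 1 <= x)) => // x y; exact: mulr_ege1.
have P0 : 0 <= \prod_j N j by lra.
(* The exact root gives the equality required by [covered_by_hyperplanes]; if some [N j > T0], the
   other factors have product at most [T0 ^ (n - 1)]. *)
pose T0 := rootr n (\prod_j N j).
have T01 : 1 <= T0 by apply: ler1_rootr.
have T0E : T0 ^+ n = \prod_j N j by exact: rootrK.
have T0T : T0 <= T.
  by rewrite -(@ler_pXn2r _ n) ?nnegrE ?rootr_ge0 ?(le_trans ler01 T1) // T0E.
have T0c : T0 ^+ c <= T ^+ c by rewrite lerXn2r ?nnegrE ?rootr_ge0 ?(le_trans ler01 T1).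
have Tc0 : 0 <= T ^+ c by rewrite exprn_ge0 // (le_trans ler01).
have [/forallP NT0|] := boolP [forall j, N j <= T0].
  apply: covered_le (hB N T0 N1 T01 (esym T0E) NT0) => //.
  by apply: ler_pM => //; rewrite ?lerDr // exprn_ge0 // rootr_ge0.
rewrite negb_forall => /existsP [j]; rewrite -ltNge => jT.
have T0p : 0 < T0 by lra.
have h : \prod_i N (lift j i) <= T0 ^+ n.-1.
  rewrite -(ler_pM2r T0p) -exprSr prednK // T0E (bigD1_ord j) //= mulrC.
  by rewrite ler_wpM2r ?prodr_ge0 // => [i _|]; exact: ltW.
rewrite subSn; last exact: ltnW.
apply: (covered_drop_coordinate (j := j)); first exact: leq_subr.
apply: covered_le (hA _ T0 (fun i => N1 (lift j i)) T01 h) => //.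
by apply: ler_pM => //; rewrite ?lerDl // exprn_ge0 // rootr_ge0.
Qed.

(** * Successive minima *)

Lemma sorting_perm n (f : 'I_n -> R) :
  exists s : {perm 'I_n}, forall i j : 'I_n, (i <= j)%N -> f (s i) <= f (s j).
Proof.
pose t := sort (fun a b => f a <= f b) (enum 'I_n).
have st : size t = n by rewrite size_sort size_enum_ord.
have ut : uniq t by rewrite sort_uniq enum_uniq.
have fI : injective (fun i : 'I_n => nth i t i).
  move=> i j e; apply: val_inj; apply/eqP.
  by rewrite /= -(nth_uniq i _ _ ut) ?st // e (set_nth_default j) ?st.
exists (perm fI) => i j ij; rewrite !permE (set_nth_default i j) ?st //.
have tot : total (fun a b => f a <= f b) by move=> a b; exact: le_total.
have tr : transitive (fun a b => f a <= f b) by move=> b a c; exact: le_trans.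
by apply: (sorted_leq_nth tr (fun a => lexx (f a)) i (sort_sorted tot _)); rewrite ?inE ?st.
Qed.

Lemma sorted_reduced_basis n : exists2 C : R, 1 <= C &
  forall m (B : 'M[R]_(n, m)), row_free B ->
  exists U : 'M[int]_n, [/\ U \in unitmx,
    forall (z : 'rV[R]_n) j,
      z 0 j ^+ 2 * sqn (row j (U^r *m B)) <= C * sqn (z *m (U^r *m B)) &
    forall i j : 'I_n, (i <= j)%N -> sqn (row i (U^r *m B)) <= sqn (row j (U^r *m B))].
Proof.
have [C C1 h] := reduced_basis n; exists C => // m B Bf.
have [U Uu hU] := h _ _ Bf.
have [s hs] := sorting_perm (fun j => sqn (row j (U^r *m B))).
have rE j : row j ((row_perm s U)^r *m B) = row (s j) (U^r *m B).
  by rewrite !row_mul; congr (_ *m _); apply/rowP => i; rewrite !mxE.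
exists (row_perm s U); split => [|z j|i j ij].
- by rewrite row_permE unitmx_mul unitmx_perm.
- rewrite rE; have := hU (z *m perm_mx s) (s j).
  rewrite -mulmxA [perm_mx s *m _]mulmxA -row_permE -map_row_perm.
  suff -> : (z *m perm_mx s) 0 (s j) = z 0 j by [].
  rewrite mxE (bigD1 j) //= !mxE eqxx mulr1 big1 ?addr0 // => l lj.
  by rewrite !mxE (inj_eq perm_inj) (negPf lj) mulr0.
- by rewrite !rE hs.
Qed.

Lemma unit_ballE d (v : 'rV[R]_d) : @unit_ball R d v <-> sqn v <= 1.
Proof. by rewrite /unit_ball /= /enorm -{1}sqrtr1 ler_sqrt. Qed.

Local Notation ball1 := (@unit_ball R _).

Lemma dilate_unit_ball d (l : R) (v : 'rV[R]_d) : 0 < l ->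
  dilate l ball1 v <-> sqn v <= l ^+ 2.
Proof.
move=> l0; have l2 : 0 < l ^+ 2 by rewrite exprn_gt0.
split=> [[x /unit_ballE x1 <-]|vl]; first by rewrite sqnZ ger_pMr.
exists (l^-1 *: v); last by rewrite scalerA divff ?scale1r // gt_eqF.
by apply/unit_ballE; rewrite sqnZ exprVn mulrC ler_pdivrMr // mul1r.
Qed.

Lemma sqnB_le d (u v : 'rV[R]_d) : sqn (u - v) <= 2 * (sqn u + sqn v).
Proof.
rewrite /sqn -big_split /= mulr_sumr; apply: ler_sum => i _; rewrite !mxE.
by have := sqr_ge0 (u 0 i + v 0 i); rewrite !expr2; lra.
Qed.

Section Lattice.
Variables (d : nat) (G : 'M[R]_d).
Hypothesis Gu : G \in unitmx.
Let L : set 'rV[R]_d := [set z^r *m G | z in [set: 'rV[int]_d]].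
Let minima_set i := [set l : R | 0 < l /\ affdim_ge (L `&` dilate l ball1) i].

Lemma lattice_diff u v : L u -> L v -> L (u - v).
Proof. by move=> [y _ <-] [z _ <-]; exists (y - z) => //; rewrite map_mxB mulmxBl. Qed.

(** The origin and the first [i] basis vectors are affinely independent. *)
Lemma minima_set_basis i (l : R) : (i <= d)%N -> 0 < l ->
  (forall j : 'I_d, (j < i)%N -> sqn (row j G) <= l ^+ 2) -> minima_set i l.
Proof.
move=> id l0 hl; split => //.
pose b (a : 'I_i) := row (widen_ord id a) G.
have Lb a : L (b a).
  by exists (delta_mx 0 (widen_ord id a)) => //; rewrite map_delta_mx -rowE.
exists (fun a => if unlift ord0 a is Some a' then b a' else 0); split.
  move=> a; case: (unliftP ord0 a) => [a' _|_].
    by split => //; apply/(dilate_unit_ball _ l0); apply: hl => /=.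
  split; first by exists 0 => //; rewrite map_mx0 mul0mx.
  apply/(dilate_unit_ball _ l0).
  by rewrite -[0](scale0r (0 : 'rV[R]_d)) sqnZ expr0n mul0r sqr_ge0.
rewrite (_ : \matrix_(a < i) _ = rowsub (widen_ord id) 1%:M *m G).
  rewrite mxrankMfree ?row_free_unit //; apply/eqP/row_freeP.
  exists (colsub (widen_ord id) 1%:M); apply/matrixP => a a'.
  rewrite !mxE (bigD1 (widen_ord id a)) //= !mxE eqxx mul1r big1 ?addr0 //.
  by move=> c ca; rewrite !mxE eq_sym (negPf ca) mul0r.
apply/row_matrixP => a; rewrite rowK liftK unlift_none subr0 row_mul.
by rewrite /b [LHS]rowE; congr (_ *m _); apply/rowP => c; rewrite !mxE eq_sym.
Qed.

(** Differences from the base point are lattice vectors, and |u - v|^2 <= 2 (|u|^2 + |v|^2) <= 4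
    l^2. *)
Lemma minima_set_diff i l : minima_set i l ->
  exists Y : 'M[int]_(i, d), \rank Y^r = i /\
    forall a, sqn ((row a Y)^r *m G) <= 4 * l ^+ 2.
Proof.
move=> [l0 [x [xL xr]]].
have hx (a : 'I_i) : exists y : 'rV[int]_d, y^r *m G = x (lift ord0 a) - x ord0.
  have [La _] := xL (lift ord0 a); have [L0 _] := xL ord0.
  by have [y _ <-] := lattice_diff La L0; exists y.
have [y hy] := fin_all_exists hx.
exists (\matrix_a y a); split.
  rewrite -[RHS]xr -(mxrankMfree _ (B := G)) ?row_free_unit //; congr (\rank _).
  apply/row_matrixP => a; rewrite row_mul -map_row !rowK; exact: hy.
move=> a; rewrite rowK hy.
apply: le_trans (sqnB_le _ _) _.
have [_ /(dilate_unit_ball _ l0) h1] := xL (lift ord0 a).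
have [_ /(dilate_unit_ball _ l0) h2] := xL ord0.
lra.
Qed.

Lemma succ_min_gt0 i : (0 < i <= d)%N -> 0 < succ_min L ball1 i.
Proof.
move=> /andP[i0 id].
have [e e0 he] := lattice_discrete (etrans (row_free_unit G) Gu).
(* A nonzero difference has squared length at least [e] and at most [4 l ^ 2]. *)
have se0 : 0 < Num.sqrt (e / 4) by rewrite sqrtr_gt0; lra.
apply: (lt_le_trans se0); apply: lb_le_inf.
  (* The infimum of the empty set is 0, so a member is needed; this one is at least the length of
     every basis vector. *)
  exists (1 + \sum_j sqn (row j G)); apply: minima_set_basis => // [|j _].
    by apply: ltr_wpDr => //; apply: sumr_ge0 => j _; exact: sqn_ge0.
  have sj : sqn (row j G) <= \sum_j sqn (row j G).
    by rewrite (bigD1 j) //= lerDl sumr_ge0 // => ? _; exact: sqn_ge0.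
  by have := sqn_ge0 (row j G); rewrite expr2; nra.
move=> l ml; have l0 : 0 < l by case: ml.
have [Y [Yr hY]] := minima_set_diff ml.
pose a : 'I_i := Ordinal i0.
have Ya : row a Y != 0.
  apply: contra_eqN Yr => /eqP Ya; rewrite neq_ltn; apply/orP; left.
  rewrite ltn_neqAle rank_leq_row andbT; apply/negP => /row_freeP [D /matrixP/(_ a a)].
  rewrite !mxE eqxx big1 => [/esym/eqP|c _]; first by rewrite oner_eq0.
  by move/rowP/(_ c): Ya; rewrite !mxE => ->; rewrite mul0r.
rewrite -(ger0_norm (ltW l0)) -sqrtr_sqr ler_sqrt ?sqr_ge0 //.
by have := he _ Ya; have := hY a; lra.
Qed.

Lemma succ_min_le (j : 'I_d) : (forall a : 'I_d, (a <= j)%N -> sqn (row a G) <= sqn (row j G)) ->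
  succ_min L ball1 j.+1 <= Num.sqrt (sqn (row j G)).
Proof.
move=> hj; apply: ge_inf; first by exists 0 => l [/ltW].
apply: minima_set_basis => // [|a aj].
  rewrite sqrtr_gt0 lt_def sqn_ge0 andbT; apply/eqP => /sqn_eq0 /eqP.
  by apply/negP; exact: row_unitmx_neq0.
by rewrite sqr_sqrtr ?sqn_ge0 // hj.
Qed.

(** Among [d] independent lattice vectors of squared length at most 16, one has a nonzero integral
    [j]-th coordinate; reducedness then bounds [row j G]. *)
Lemma basis_bounded (C : R) : (0 < d)%N -> 1 <= C ->
  (forall (z : 'rV[R]_d) j, z 0 j ^+ 2 * sqn (row j G) <= C * sqn (z *m G)) ->
  succ_min L ball1 d <= 1 -> forall j, sqn (row j G) <= 16 * C.
Proof.
move=> d0 C1 red sm j.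
(* Some [l < 2] works even if the infimum is not attained, whence 16 = 4 * 2^2. An empty set would
   make the minimum 0. *)
have [l ml l2] : exists2 l, minima_set d l & l < 2.
  have hi : has_inf (minima_set d).
    split; last by exists 0 => l [/ltW].
    apply: contrapT => /set0P/negP/negPn/eqP m0.
    by have := @succ_min_gt0 d; rewrite d0 leqnn /succ_min -/(minima_set d) m0 inf0 ltxx => /(_ isT).
  have [l ml hl] := inf_adherent ltr01 hi; exists l => //.
  by apply: lt_le_trans hl _; rewrite -[leRHS]/(1 + 1) lerD2r.
have l0 : 0 < l by case: ml.
have [Y [Yr hY]] := minima_set_diff ml.
have [a Ya] : exists a, Y a j != 0.
  apply/existsP; apply: contraT; rewrite negb_exists => /forallP h.
  have /row_freeP [D] : row_free (Y^r)^T by rewrite /row_free mxrank_tr Yr.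
  move/matrixP/(_ j j); rewrite !mxE eqxx big1 => [/esym/eqP|c _]; first by rewrite oner_eq0.
  by have /negPn/eqP h0 := h c; rewrite !mxE h0 mul0r.
have := red (row a Y)^r j; rewrite !mxE => h.
have y1 : 1 <= ((Y a j)%:~R : R) ^+ 2.
  by rewrite -real_normK ?num_real // exprn_ege1 // int_norm_ge1.
have := hY a; have := sqn_ge0 (row j G).
have l4 : l ^+ 2 <= 4 by rewrite expr2; nra.
nra.
Qed.

End Lattice.

(** * Covering the lattice points of the ball *)

Lemma bigmin_attained (F : nat -> R) a b : (a <= b)%N ->
  exists2 i, (a <= i <= b)%N & \big[Num.min/F b]_(a <= i < b.+1) F i = F i.
Proof.
move=> ab; rewrite big_seq_cond; elim/big_ind : _.
(* The default value [F b] is itself one of the terms. *)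
- by exists b; rewrite ?ab ?leqnn.
- move=> _ _ [i hi ->] [j hj ->]; rewrite /Num.min; case: ifP => _.
    by exists i.
  by exists j.
- by move=> i /andP[]; rewrite mem_index_iota ltnS => hi _; exists i.
Qed.

(** The two reversals shift indices by [d - i], so that the last [i] coordinates are kept. *)
Lemma covered_drop_first d i k (id : (i <= d)%N) (N : 'I_d -> R) (M : R) :
  (k <= i)%N ->
  covered k (inbox (fun a : 'I_i => N (rev_ord (widen_ord id (rev_ord a))))) M ->
  covered (d - i + k) (inbox N) M.
Proof.
move=> ki; set f := fun a : 'I_i => rev_ord (widen_ord id (rev_ord a)).
have fI : injective f.
  by move=> a b /rev_ord_inj /(congr1 val) /= e; apply/rev_ord_inj/val_inj.
move=> h; apply: (covered_preimage (A := colsub f 1%:M) _ ki _ h).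
  rewrite /row_full -mxrank_tr; apply/row_freeP; exists (colsub f 1%:M).
  apply/matrixP => a b; rewrite !mxE (bigD1 (f a)) //= !mxE eqxx mul1r (inj_eq fI).
  by rewrite big1 ?addr0 // => c ca; rewrite !mxE (negPf ca) mul0r.
move=> z zN a; rewrite (_ : (z *m _) 0 a = z 0 (f a)); first exact: zN.
rewrite mxE (bigD1 (f a)) //= !mxE eqxx mulr1 big1 ?addr0 // => c ca.
by rewrite !mxE (negPf ca) mulr0.
Qed.

Lemma alpha_term_expr d (L : set 'rV[R]_d) i : (1 < i)%N ->
  0 < \prod_(d - i + 1 <= j < d.+1) succ_min L ball1 j ->
  alpha_term L i ^+ i.-1 = (\prod_(d - i + 1 <= j < d.+1) succ_min L ball1 j)^-1.
Proof.
move=> i1 P0; rewrite /alpha_term -powR_mulrn ?powR_ge0 // -powRrM.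
rewrite subn1 mulNr mulVf; first by rewrite powR_inv1 // ltW.
by rewrite pnatr_eq0; lia.
Qed.

Lemma alpha_term_ge0 d (L : set 'rV[R]_d) i : 0 <= alpha_term L i.
Proof. exact: powR_ge0. Qed.

Lemma lattice_reindex d (B : 'M[R]_d) (U : 'M[int]_d) : U \in unitmx ->
  [set z^r *m B | z in [set: 'rV[int]_d]] =
  [set z^r *m (U^r *m B) | z in [set: 'rV[int]_d]].
Proof.
move=> Uu; apply/seteqP; split => _ [z _ <-].
  by exists (z *m invmx U) => //; rewrite mulmxA -map_mxM mulmxKV.
by exists (z *m U) => //; rewrite map_mxM mulmxA.
Qed.

Lemma lattice_cover_alpha_term d c i : (0 < c < i)%N -> (i <= d)%N ->
  exists2 C : R, 0 <= C & forall L : set 'rV[R]_d, is_lattice L ->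
    succ_min L ball1 d <= 1 -> exists s : seq 'M[R]_d,
    [/\ forall U, U \in s -> \rank U = (d - c)%N,
        forall v, L v -> ball1 v -> exists2 U, U \in s & (v <= U)%MS &
        (size s)%:R <= C * alpha_term L i ^+ c].
Proof.
move=> /andP[c0 ci] id.
have [C0 C01 RB] := sorted_reduced_basis d.
have [C1 C10 CB] := covered_box ci.
pose ka : R := 16 * C0.
have ka1 : 1 <= ka by rewrite /ka; lra.
exists (C1 * (ka ^+ 2) ^+ c) => [|_ [B [Bu ->]]].
  by rewrite mulr_ge0 // !exprn_ge0 // /ka; lra.
have Bf : row_free B by rewrite row_free_unit.
have [U [Uu red srt]] := RB _ _ Bf.
rewrite (lattice_reindex B Uu); set G := U^r *m B; set L := (X in succ_min X) => sm.
rewrite -/G in red srt.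
have Gu : G \in unitmx by rewrite unitmx_mul toR_unitmx.
have d0 : (0 < d)%N by apply: leq_trans id; exact: leq_ltn_trans ci.
have bb := basis_bounded Gu d0 C01 red sm.
pose be j := Num.sqrt (sqn (row j G)).
have be0 j : 0 < be j.
  rewrite sqrtr_gt0 lt_def sqn_ge0 andbT; apply/eqP => /sqn_eq0 /eqP.
  by apply/negP; exact: row_unitmx_neq0.
have be2 j : be j ^+ 2 = sqn (row j G) by rewrite sqr_sqrtr ?sqn_ge0.
have ka2 : 16 * C0 <= ka ^+ 2 by rewrite -/ka expr2 ler_peMr //; lra.
have beka j : be j <= ka.
  by rewrite -(ger0_norm (ltW (be0 j))); apply: norm_le_sqr; rewrite ?be2 ?(le_trans (bb j)) //; lra.
(* Reducedness confines the coordinates of lattice points of the ball to these bounds, and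
   [be j <= ka] makes them at least 1. *)
pose N j := ka / be j.
have N1 j : 1 <= N j by rewrite ler_pdivlMr // mul1r.
pose f (a : 'I_i) := rev_ord (widen_ord id (rev_ord a)).
have fE a : f a = (a + (d - i))%N :> nat by have := ltn_ord a; rewrite /f /=; clear -id; lia.
set al := alpha_term L i.
have al0 : 0 <= al by exact: alpha_term_ge0.
pose P := \prod_(d - i + 1 <= j < d.+1) succ_min L ball1 j.
have PE : P = \prod_(a < i) succ_min L ball1 (f a).+1.
  rewrite /P -[X in \prod_(X <= _ < _) _]add0n big_addn.
  have -> : (d.+1 - (d - i + 1) = i)%N by clear -id; lia.
  by rewrite big_mkord; apply: eq_bigr => a _; rewrite fE addn1 addnS.
have sp a : 0 < succ_min L ball1 (f a).+1 by apply: (succ_min_gt0 Gu); exact: (ltn_ord (f a)).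
have P0 : 0 < P by rewrite PE prodr_gt0.
have Pbe : P <= \prod_a be (f a).
  rewrite PE; apply: ler_prod => a _; rewrite (ltW (sp a)) andTb.
  by apply: (succ_min_le Gu) => b bfa; exact: srt.
(* The volume is at most [ka ^ i / P = ka ^ i * al ^ (i - 1)]; the square of [ka] absorbs [ka ^ i],
   as [i <= 2 (i - 1)]. *)
pose T := ka ^+ 2 * al.
have i1 : (1 < i)%N by exact: leq_ltn_trans ci.
have TP : \prod_a N (f a) <= T ^+ i.-1.
  rewrite exprMn alpha_term_expr // prodf_div prodr_const card_ord -exprM.
  have bp : 0 < \prod_a be (f a) by apply: prodr_gt0.
  apply: ler_pM.
  - by rewrite exprn_ge0 //; lra.
  - by rewrite invr_ge0 ltW.
  - by rewrite ler_weXn2l //; clear -i1; lia.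
  - by rewrite lef_pV2.
have T1 : 1 <= T.
  have NP1 : 1 <= \prod_a N (f a).
    by apply: (big_ind (fun x : R => 1 <= x)) => // x y; exact: mulr_ege1.
  rewrite leNgt; apply/negP => T1.
  have : T ^+ i.-1 < 1 by rewrite exprn_ilt1 // ?mulr_ge0 ?exprn_ge0 //; [clear -i1; lia|lra|lra].
  by apply/negP; rewrite -leNgt (le_trans NP1).
have cov := CB (fun a => N (f a)) T (fun a => N1 (f a)) T1 TP.
have [s [h1 h2 h3]] := covered_drop_first (leq_subr _ _) cov.
exists [seq V *m G | V <- s]; split.
- move=> _ /mapP [V Vs ->]; rewrite mxrankMfree ?row_free_unit // h1 //; clear -ci id; lia.
- move=> _ [y _ <-] yb.
  have [|V Vs yV] := h2 y; last first.
    by exists (V *m G); [exact: map_f|rewrite submxMr].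
  move=> j; rewrite ler_pdivlMr //.
  rewrite -[leLHS]ger0_norm; last by rewrite mulr_ge0 // ltW.
  apply: norm_le_sqr; first by lra.
  rewrite exprMn real_normK ?num_real // be2.
  have := red y^r j; rewrite mxE.
  have : sqn (y^r *m G) <= 1.
    by apply/unit_ballE.
  have := sqn_ge0 (y^r *m G); nra.
- by rewrite size_map -mulrA -exprMn.
Qed.

End Covering.

Unset Implicit Arguments.

Theorem theorem11 (R : realType) (d k : nat) :
  (1 <= k)%N -> (k <= d - 1)%N ->
  exists C : R,
    forall L : set 'rV[R]_d,
      is_lattice L ->
      succ_min L (@unit_ball R d) d <= 1 ->
      exists s : seq 'M[R]_d,
        (forall U, U \in s -> \rank U = k) /\
        (forall v, L v -> @unit_ball R d v -> exists2 U, U \in s & (v <= U)%MS) /\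
        (size s)%:R <= C * alpha k L ^+ (d - k).
Proof.
move=> k1 kd.
(* The index attaining the minimum depends on [L], so each [i] gets its own constant, 0 for
   [i <= d - k], and their sum serves for every [L]. *)
have h (i : 'I_d.+1) : exists C : R, 0 <= C /\ ((d - k < i)%N ->
    forall L : set 'rV[R]_d, is_lattice L ->
    succ_min L (@unit_ball R d) d <= 1 -> exists s : seq 'M[R]_d,
    [/\ forall U, U \in s -> \rank U = k,
        forall v, L v -> @unit_ball R d v -> exists2 U, U \in s & (v <= U)%MS &
        (size s)%:R <= C * alpha_term L i ^+ (d - k)]).
  have [ki|_] := boolP (d - k < i)%N; last by exists 0.
  have cki : (0 < d - k < i)%N by rewrite ki andbT; lia.
  have [C C0 hC] := lattice_cover_alpha_term R cki (ltn_ord i).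
  exists C; split => // _ L hL sm; have [s [s1 s2 s3]] := hC L hL sm.
  by exists s; split => // U /s1 ->; lia.
have [C hC] := fin_all_exists h.
have C0 i : 0 <= C i by case: (hC i).
exists (\sum_i C i) => L hL sm.
have dkd : (d - k + 1 <= d)%N by lia.
have [i /andP[ki id] aE] := bigmin_attained (fun i => alpha_term L i) dkd.
pose i' : 'I_d.+1 := inord i.
have i'E : i' = i :> nat by rewrite inordK.
have [_ hi] := hC i'; have [|s [s1 s2 s3]] := hi _ L hL sm.
  by rewrite i'E; lia.
exists s; split => //; split => //; apply: le_trans s3 _.
rewrite /alpha aE i'E ler_wpM2r ?exprn_ge0 ?alpha_term_ge0 //.
by rewrite (bigD1 i') //= lerDl sumr_ge0.
Qed.
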